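(* The class of permutation graphs admits $\mathrm{FP{+}C}$-definable canonization.
   Context: Graphs are finite, simple, undirected, with nonempty vertex set. A realizer of $G=(V,E)$ is a pair $(<_1,<_2)$ of strict linear orders on $V$ such that distinct $u,v$ are adjacent iff they appear in different orders in $<_1$ and $<_2$; $G$ is a permutation graph if it has a realizer. $\mathrm{FP{+}C}$ is inflationary fixed-point logic with counting (two-sorted, with number sort $[0,|V|]$). A class $\mathcal{C}$ of graphs admits $\mathrm{FP{+}C}$-definable canonization if there is an $\mathrm{FP{+}C}[\{E\},\{E,\le\}]$-transduction $\Theta$ (a tuple of $\mathrm{FP{+}C}$-formulas defining a domain, a universe over tuples of variables modulo a definable equivalence relation, and each relation of the output structure) such that for every $G\in\mathcal{C}$, $G$ is in the domain of $\Theta$ and $\Theta[G]$ is an ordered copy of $G$, i.e., a structure $(V',E',\le)$ with $\le$ a linear order on $V'$ and $(V',E')\cong G$. *)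

(* Defs.v *)
From mathcomp Require Import all_boot.
Set Implicit Arguments.
Unset Strict Implicit.
Unset Printing Implicit Defensive.

Definition simple_graph (V : finType) (e : rel V) : Prop :=
  0 < #|V| /\ symmetric e /\ irreflexive e.

Definition strict_linear_order (V : finType) (lt : rel V) : Prop :=
  irreflexive lt /\ transitive lt /\ (forall u v, u != v -> lt u v || lt v u).

Definition realizer (V : finType) (e : rel V) (lt1 lt2 : rel V) : Prop :=
  strict_linear_order lt1 /\ strict_linear_order lt2 /\
  (forall u v, u != v -> e u v = (lt1 u v != lt2 u v)).

Definition permutation_graph (V : finType) (e : rel V) : Prop :=
  exists lt1 lt2 : rel V, realizer e lt1 lt2.

(* FP+C : inflationary fixed-point logic with counting (Graedel-Otto    *)
(* style), over the vocabulary {E}.  Two sorts: vertices (V) and        *)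
(* numbers [0,|V|] = 'I_(#|V|).+1 with their linear order.              *)
(* Individual variables are nats; their sort is determined by the       *)
(* binder (FExV binds a vertex, FExN a number).  Relation variables     *)
(* (for fixed points) are nats, interpreted by sets of mixed tuples.    *)

Inductive fpc : Type :=
| FEdge of nat & nat
| FEq   of nat & nat
| FLe   of nat & nat
| FRel  of nat & seq nat
| FCnt  of nat & fpc & nat              (* #_x phi = p  (x vertex variable,
                                           p number variable) *)
| FNot  of fpc
| FAnd  of fpc & fpc
| FExV  of nat & fpc
| FExN  of nat & fpc
| FIfp  of nat & seq (nat * bool) & fpc & seq nat.
  (* [ifp_{R, x1..xk} phi](t1..tk); each xi comes with its sort
     (true = vertex sort, false = number sort) *)

Definition value (V : finType) : finType := (V + 'I_(#|V|).+1)%type.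

Definition sort_ok (V : finType) (s : bool) (v : value V) : bool :=
  match v with inl _ => s | inr _ => ~~ s end.

Definition wellsorted (V : finType) (ss : seq bool) (a : seq (value V)) : bool :=
  (size a == size ss) && all2 (fun s v => sort_ok s v) ss a.

Definition upd (T : Type) (f : nat -> T) (x : nat) (v : T) : nat -> T :=
  fun y => if y == x then v else f y.

Fixpoint updl (T : Type) (f : nat -> T) (xs : seq nat) (vs : seq T) : nat -> T :=
  match xs, vs with
  | x :: xs', v :: vs' => updl (upd f x v) xs' vs'
  | _, _ => f
  end.

Definition updR (V : finType) (f : nat -> seq (value V) -> bool) (r : nat)
  (S : seq (value V) -> bool) : nat -> seq (value V) -> bool :=
  fun y => if y == r then S else f y.

(* Semantics.  The inflationary fixed point is computed by iterating the
   inflationary stage operator (#|value V|)^k times, which is at least the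
   number of well-sorted k-tuples, hence enough to reach the fixed point. *)
Fixpoint sem (V : finType) (e : rel V) (phi : fpc) (env : nat -> value V)
  (renv : nat -> seq (value V) -> bool) {struct phi} : bool :=
  match phi with
  | FEdge x y => match env x, env y with inl u, inl v => e u v | _, _ => false end
  | FEq x y => env x == env y
  | FLe x y => match env x, env y with
               | inr i, inr j => nat_of_ord i <= nat_of_ord j | _, _ => false end
  | FRel r ts => renv r (map env ts)
  | FCnt x psi p =>
      match env p with
      | inr i => #|[set v : V | sem e psi (upd env x (inl v)) renv]| == nat_of_ord i
      | inl _ => false
      end
  | FNot psi => ~~ sem e psi env renv
  | FAnd psi chi => sem e psi env renv && sem e chi env renv
  | FExV x psi => [exists v : V, sem e psi (upd env x (inl v)) renv]
  | FExN x psi => [exists i : 'I_(#|V|).+1, sem e psi (upd env x (inr i)) renv]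
  | FIfp r xs psi ts =>
      let step (S : seq (value V) -> bool) : seq (value V) -> bool :=
        fun a => S a || (wellsorted (map snd xs) a &&
                         sem e psi (updl env (map fst xs) a) (updR renv r S)) in
      iter (#|value V| ^ size xs) step (fun _ => false) (map env ts)
  end.

(* default assignments: unassigned individual variables denote the number 0
   (an FP+C-definable constant), relation variables denote the empty set *)
Definition val0 (V : finType) : value V := inr ord0.
Definition renv0 (V : finType) : nat -> seq (value V) -> bool := fun _ _ => false.
Definition tenv (V : finType) (a : seq (value V)) : nat -> value V :=
  fun i => nth (val0 V) a i.

(* t_sorts = the sorts of the tuple x = (x_0..x_{m-1}) of universe       *)
(* variables; the formulas use variables 0..m-1 for x and m..2m-1 for   *)
(* the second tuple y.  t_dom is a sentence, t_univ(x), t_eqv(x,y),     *)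
(* t_edge(x,y), t_le(x,y).                                              *)

Record transduction := Transduction {
  t_sorts : seq bool;
  t_dom   : fpc;
  t_univ  : fpc;
  t_eqv   : fpc;
  t_edge  : fpc;
  t_le    : fpc }.

Definition ttuple (T : transduction) (V : finType) : finType :=
  (size (t_sorts T)).-tuple (value V).

Definition t_universe (T : transduction) (V : finType) (e : rel V)
  : {set ttuple T V} :=
  [set a : ttuple T V | wellsorted (t_sorts T) a && sem e (t_univ T) (tenv a) (@renv0 V)].

Definition t_eq (T : transduction) (V : finType) (e : rel V) (a b : ttuple T V) : bool :=
  sem e (t_eqv T) (tenv (tval a ++ tval b)) (@renv0 V).

Definition t_classes (T : transduction) (V : finType) (e : rel V)
  : {set {set ttuple T V}} :=
  [set [set b in t_universe T e | t_eq e a b] | a in t_universe T e].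

Definition out_edge (T : transduction) (V : finType) (e : rel V)
  (C D : {set ttuple T V}) : bool :=
  [exists a in C, exists b in D, sem e (t_edge T) (tenv (tval a ++ tval b)) (@renv0 V)].

Definition out_le (T : transduction) (V : finType) (e : rel V)
  (C D : {set ttuple T V}) : bool :=
  [exists a in C, exists b in D, sem e (t_le T) (tenv (tval a ++ tval b)) (@renv0 V)].

Definition canonizes (T : transduction) (V : finType) (e : rel V) : Prop :=
  let U := t_universe T e in
  let Q := t_classes T e in
  [/\ sem e (t_dom T) (fun _ => val0 V) (@renv0 V),
      [/\ (forall a, a \in U -> t_eq e a a),
      (forall a b, a \in U -> b \in U -> t_eq e a b -> t_eq e b a)
      & (forall a b c, a \in U -> b \in U -> c \in U ->
          t_eq e a b -> t_eq e b c -> t_eq e a c)],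
      [/\ (forall C D, C \in Q -> D \in Q -> out_le e C D -> out_le e D C -> C = D),
          (forall C D F, C \in Q -> D \in Q -> F \in Q ->
              out_le e C D -> out_le e D F -> out_le e C F) &
          (forall C D, C \in Q -> D \in Q -> out_le e C D || out_le e D C)] &
      exists f : V -> {set ttuple T V},
        [/\ injective f, f @: setT = Q & forall u v, e u v = out_edge e (f u) (f v)]].

Definition admits_FPC_canonization
  (C : forall V : finType, rel V -> Prop) : Prop :=
  exists T : transduction,
    forall (V : finType) (e : rel V), simple_graph e -> C V e -> canonizes T e.

(* Main.v *)
Require Import Defs.
From mathcomp Require Import all_boot zify.
From Stdlib Require Import FunctionalExtensionality.
Set Implicit Arguments.
Unset Strict Implicit.
Unset Printing Implicit Defensive.

(* The graph is decomposed recursively: a class B splits into the maximal strong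
   modules of G[B].  They are definable because, with m(x, y) the least module
   of G[B] containing x and y, two distinct vertices x, y of B lie in the same
   part iff some z in B has z \notin m(x, y) and y \in m(x, z).  An ordered copy of
   every class, a graph on an initial segment of the numbers, is computed from
   the leaves up.  If the adjacency between distinct parts of B is constant, the
   copies of the parts are sorted lexicographically, and equal ones are counted.
   Otherwise a choice of the first part in the order <1 of a realizer determines
   the orders of all parts: <1 and <2 are transitive, and each gives the other
   on B by adjacency, so one closes off under transitivity of both.  Each first
   part for which this closure totally orders the parts yields an ordered copy of
   G[B]; the lexicographically least one is taken.  Correctness never needs
   invariance under isomorphism, as this is automatic for formulas. *)

(** * Inflationary fixed points *)

(** No realizer can be singled out by a formula: automorphisms exchange parts with equal copies, and
    no definable order separates them. Hence nothing is ever chosen among such parts. A position is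
    written as an offset, a multiple [q] of the common size and a remainder [r], and every vertex of
    every tied part may serve as a witness. When the quotient has both edges and nonedges, the first
    part is the only freedom left, so the candidates are indexed by vertices. A realizer serves only
    to show that some first part is valid; that a valid one yields a copy follows from the checkable
    definition of [valid]. The recursion uses the preceding level under negation and in counting
    terms, so its fixed points are not monotone. Each level is therefore guarded by a test that the
    preceding one is present, and enters completely in a single round. *)

Section Ifp.
Variables (T : finType) (F : {set T} -> {set T}).

Definition infl (X : {set T}) := X :|: F X.
Definition ifp := iter #|T| infl set0.

Lemma iter_inflS m : iter m infl set0 \subset iter m.+1 infl set0.
Proof. by rewrite iterS subsetUl. Qed.

(** If round [m] still added something, then so did every earlier round, and [m.+1] rounds would
    collect more than [#|T|] elements. *)
Lemma iter_infl_stable m : #|T| <= m -> infl (iter m infl set0) = iter m infl set0.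
Proof.
move=> le_Tm; apply/eqP; rewrite -iterS eq_sym; apply/negPn/negP => neq.
have mono k : k <= m -> iter k infl set0 != iter k.+1 infl set0.
  move=> le_km; apply: contra_neq neq => eqk.
  rewrite -(subnK le_km); elim: (m - k) => [|j IHj] //.
  by rewrite addSn [LHS]iterS IHj.
have big k : k <= m.+1 -> k <= #|iter k infl set0|.
  elim: k => // k IHk lt_km; apply: leq_ltn_trans (IHk (ltnW lt_km)) _.
  by apply: proper_card; rewrite properEneq mono //= iter_inflS.
have := leq_trans (big _ (leqnn _)) (max_card (mem (iter m.+1 infl set0))).
by rewrite ltnNge le_Tm.
Qed.

Lemma iter_infl_ifp m : #|T| <= m -> iter m infl set0 = ifp.
Proof.
move=> le_Tm; rewrite -(subnK le_Tm); elim: (m - #|T|) => // k IHk.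
by rewrite addSn iterS IHk iter_infl_stable.
Qed.

Lemma ifp_closed : F ifp \subset ifp.
Proof. by rewrite -{2}[ifp]iter_infl_stable // subsetUr. Qed.

(** The hypothesis ranges over all subsets [X] of [S] because, for a step that may fail to be
    monotone, a bound on [F S] alone says nothing about the stages. *)
Lemma ifp_min (S : {set T}) :
  (forall X : {set T}, X \subset S -> F X \subset S) -> ifp \subset S.
Proof.
move=> closedS; rewrite /ifp; elim: #|T| => [|m IHm]; first exact: sub0set.
by rewrite iterS subUset IHm closedS.
Qed.

(** A step that is not monotone is handled by knowing each stage exactly: after [k] rounds it
    consists of the elements of [S] of level below [k], and [#|T|] rounds exhaust the levels. *)
Lemma ifp_staged (S : {set T}) (lvl : T -> nat) :
    (forall u, lvl u < #|T|) ->
    (forall k (X : {set T}), (forall u, (u \in X) = (u \in S) && (lvl u < k)) ->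
       forall u, (u \in X) || (u \in F X) = (u \in S) && (lvl u < k.+1)) ->
  ifp = S.
Proof.
move=> ltT stage.
have stages k u : (u \in iter k infl set0) = (u \in S) && (lvl u < k).
  elim: k u => [|k IHk] u; first by rewrite inE andbF.
  by rewrite iterS inE (stage k).
by apply/setP=> u; rewrite stages ltT andbT.
Qed.

End Ifp.

(** * Semantics of formulas *)

(* Locked so that [sem_not] does not unfold it. *)
Definition fLt := locked (fun i j => FNot (FLe j i)).
Definition fOr p q := FNot (FAnd (FNot p) (FNot q)).
Definition fIte b p q := fOr (FAnd b p) (FAnd (FNot b) q).
Definition fAllV x p := FNot (FExV x (FNot p)).
Definition fAllN x p := FNot (FExN x (FNot p)).
Definition fIff p q := fIte p q (FNot q).
Definition fSucc := locked (fun z i j =>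
  FAnd (fLt i j) (FNot (FExN z (FAnd (fLt i z) (fLt z j))))).
Definition fZero := locked (fun z i => FNot (FExN z (fLt z i))).
Definition fMax := locked (fun z i => FNot (FExN z (fLt i z))).

(* A fixed point whose body ignores its relation variable acts as a call: the
   variables 0, 1, .. of [p] are bound to the values of [ts]. *)
Definition fCall (ss : seq bool) p ts := FIfp 9 (zip (iota 0 (size ss)) ss) p ts.

Section Sem.
Variables (V : finType) (e : rel V).
Implicit Types (env : nat -> value V) (renv : nat -> seq (value V) -> bool).
Local Notation num := 'I_(#|V|).+1.

Lemma sem_and p q env renv :
  sem e (FAnd p q) env renv = sem e p env renv && sem e q env renv.
Proof. by []. Qed.

Lemma sem_not p env renv : sem e (FNot p) env renv = ~~ sem e p env renv.
Proof. by []. Qed.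

Lemma sem_or p q env renv :
  sem e (fOr p q) env renv = sem e p env renv || sem e q env renv.
Proof. by rewrite /= negb_and !negbK. Qed.

Lemma sem_ite b p q env renv :
  sem e (fIte b p q) env renv
    = if sem e b env renv then sem e p env renv else sem e q env renv.
Proof. by rewrite /fIte sem_or /=; case: (sem e b env renv); rewrite ?orbF. Qed.

Lemma sem_iff p q env renv :
  sem e (fIff p q) env renv = (sem e p env renv == sem e q env renv).
Proof. by rewrite /fIff sem_ite /=; do 2!case: (sem e _ _ _). Qed.

Lemma sem_exV x p env renv :
  sem e (FExV x p) env renv = [exists v : V, sem e p (upd env x (inl v)) renv].
Proof. by []. Qed.

Lemma sem_exN x p env renv :
  sem e (FExN x p) env renv = [exists i : num, sem e p (upd env x (inr i)) renv].
Proof. by []. Qed.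

Lemma sem_allV x p env renv :
  sem e (fAllV x p) env renv = [forall v : V, sem e p (upd env x (inl v)) renv].
Proof. by rewrite /= -[RHS]negbK negb_forall. Qed.

Lemma sem_allN x p env renv :
  sem e (fAllN x p) env renv = [forall i : num, sem e p (upd env x (inr i)) renv].
Proof. by rewrite /= -[RHS]negbK negb_forall. Qed.

Lemma sem_lt x y (i j : num) env renv : env x = inr i -> env y = inr j ->
  sem e (fLt x y) env renv = (i < j).
Proof. by rewrite /fLt -lock => /= -> ->; rewrite -ltnNge. Qed.

Definition semE := (sem_iff, sem_ite, sem_or, sem_allV, sem_allN,
  sem_exV, sem_exN, sem_not, sem_and).

Lemma sem_edge x y u v env renv : env x = inl u -> env y = inl v ->
  sem e (FEdge x y) env renv = e u v.
Proof. by move=> /= -> ->. Qed.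

Lemma sem_eqN x y (i j : num) env renv : env x = inr i -> env y = inr j ->
  sem e (FEq x y) env renv = (i == j).
Proof. by move=> /= -> ->. Qed.

Lemma sem_succ z x y (i j : num) env renv : z != x -> z != y ->
    env x = inr i -> env y = inr j ->
  sem e (fSucc z x y) env renv = (j == i.+1 :> nat).
Proof.
move=> /negPf zx /negPf zy ex ey; rewrite /fSucc -lock !semE (sem_lt _ ex ey).
have updx k : upd env z (inr k) x = inr i by rewrite /upd eq_sym zx.
have updy k : upd env z (inr k) y = inr j by rewrite /upd eq_sym zy.
have updz (k : num) : upd env z (inr k) z = inr k by rewrite /upd eqxx.
apply/andP/eqP => [[lt_ij /existsPn none]|j_eq]; last first.
  rewrite j_eq ltnSn; split=> //; apply/existsPn => k.
  rewrite !semE (sem_lt _ (updx k) (updz k)) (sem_lt _ (updz k) (updy k)) j_eq ltnS.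
  by apply/negP=> /andP[/leq_trans/[apply]]; rewrite ltnn.
apply/eqP; rewrite eqn_leq lt_ij andbT leqNgt; apply/negP=> lt_i1j.
have lt_i1 := ltn_trans lt_i1j (ltn_ord j).
have := none (Ordinal lt_i1).
rewrite !semE (sem_lt _ (updx _) (updz _)) (sem_lt _ (updz _) (updy _)) /=.
by rewrite ltnSn lt_i1j.
Qed.

Lemma sem_zero z x (i : num) env renv : z != x -> env x = inr i ->
  sem e (fZero z x) env renv = (i == ord0).
Proof.
move=> /negPf zx ex; rewrite /fZero -lock !semE.
have updx k : upd env z (inr k) x = inr i by rewrite /upd eq_sym zx.
have updz (k : num) : upd env z (inr k) z = inr k by rewrite /upd eqxx.
apply/existsPn/eqP => [none|i0 k].
  have := none ord0; rewrite (sem_lt _ (updz _) (updx _)) -leqNgt leqn0 => /eqP i0.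
  exact: val_inj.
by rewrite (sem_lt _ (updz _) (updx _)) i0.
Qed.

Lemma sem_max z x (i : num) env renv : z != x -> env x = inr i ->
  sem e (fMax z x) env renv = (i == #|V| :> nat).
Proof.
move=> /negPf zx ex; rewrite /fMax -lock !semE.
have updx k : upd env z (inr k) x = inr i by rewrite /upd eq_sym zx.
have updz (k : num) : upd env z (inr k) z = inr k by rewrite /upd eqxx.
apply/existsPn/eqP => [none|i_max k].
  have := none ord_max; rewrite (sem_lt _ (updx _) (updz _)) -leqNgt => le_i.
  by apply/eqP; rewrite eqn_leq le_i -ltnS ltn_ord.
by rewrite (sem_lt _ (updx _) (updz _)) i_max -leqNgt -ltnS ltn_ord.
Qed.

Lemma sem_cnt x p y (k : num) (P : pred V) env renv : env y = inr k ->
    (forall v, sem e p (upd env x (inl v)) renv = P v) ->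
  sem e (FCnt x p y) env renv = (#|[set v | P v]| == k).
Proof. by move=> /= -> semP; under eq_finset do rewrite semP. Qed.

(** The first round decides and the later ones reproduce its answer. Relation variables other than 9
    keep their meaning, so a called formula can read the fixed point under construction around
    it. *)
Lemma sem_call ss p ts env renv b : wellsorted ss (map env ts) ->
    (forall S, sem e p (updl env (iota 0 (size ss)) (map env ts)) (updR renv 9 S) = b) ->
  sem e (fCall ss p ts) env renv = b.
Proof.
move=> sorted_ts semP; rewrite /fCall /=.
have [-> ->] : map fst (zip (iota 0 (size ss)) ss) = iota 0 (size ss) /\
               map snd (zip (iota 0 (size ss)) ss) = ss.
  by split; [apply: unzip1_zip | apply: unzip2_zip]; rewrite size_iota.
have : 0 < #|value V| ^ size (zip (iota 0 (size ss)) ss).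
  by rewrite expn_gt0 (cardD1 (inr ord0)).
case: (_ ^ _) => // m _; rewrite iterS sorted_ts semP.
case: b semP => semP; first by rewrite orbT.
rewrite orbF; elim: m => // m IHm.
by rewrite iterS IHm semP andbF.
Qed.

Section FixedPoint.
Variables (T : finType) (enc : T -> seq (value V)).
Hypothesis enc_inj : injective enc.

Definition encS (X : {set T}) a := [exists u in X, enc u == a].

Lemma encSE (X : {set T}) u : encS X (enc u) = (u \in X).
Proof.
apply/exists_inP/idP => [[w wX /eqP/enc_inj <-] //|uX].
by exists u.
Qed.

Lemma sem_ifp r xs p ts env renv (F : {set T} -> {set T}) u :
    (forall a, wellsorted (map snd xs) a = [exists w, enc w == a]) ->
    (forall X w, sem e p (updl env (map fst xs) (enc w)) (updR renv r (encS X))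
                 = (w \in F X)) ->
    map env ts = enc u ->
  sem e (FIfp r xs p ts) env renv = (u \in ifp F).
Proof.
move=> sorted_enc semP eq_ts.
have iterE m : iter m (fun S a => S a || (wellsorted (map snd xs) a &&
     sem e p (updl env (map fst xs) a) (updR renv r S))) (fun=> false)
   = encS (iter m (infl F) set0).
  elim: m => [|m IHm]; apply: functional_extensionality => a.
    by rewrite /=; symmetry; apply/negbTE/negP => /exists_inP[w]; rewrite inE.
  rewrite iterS {}IHm sorted_enc.
  have [/existsP[w /eqP<-]|/existsPn none] := boolP [exists w, enc w == a].
    by rewrite semP !encSE inE.
  by rewrite orbF; apply/exists_inP/exists_inP=> -[w _]; rewrite (negPf (none w)).
rewrite /= iterE eq_ts encSE iter_infl_ifp //.
(* The number of rounds prescribed by [sem] suffices since [enc] embeds [T] into the tuples of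
   length [size xs]. *)
have sz_enc w : size (enc w) == size xs.
  have : wellsorted (map snd xs) (enc w) by rewrite sorted_enc; apply/existsP; exists w.
  by case/andP; rewrite size_map.
rewrite -card_tuple; apply: (leq_card (fun w => Tuple (sz_enc w))) => w1 w2 [].
exact: enc_inj.
Qed.

End FixedPoint.

Definition encV (x : V) : seq (value V) := [:: inl x].
Definition encVV (u : V * V) : seq (value V) := [:: inl u.1; inl u.2].
Definition encNVV (u : num * V * V) : seq (value V) := [:: inr u.1.1; inl u.1.2; inl u.2].
Definition encNNN (u : num * num * num) : seq (value V) :=
  [:: inr u.1.1; inr u.1.2; inr u.2].
Definition encNVNN (u : num * V * num * num) : seq (value V) :=
  [:: inr u.1.1.1; inl u.1.1.2; inr u.1.2; inr u.2].

Lemma encV_inj : injective encV.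
Proof. by move=> x y []. Qed.
Lemma encVV_inj : injective encVV.
Proof. by move=> [? ?] [? ?] [/= -> ->]. Qed.
Lemma encNVV_inj : injective encNVV.
Proof. by move=> [[? ?] ?] [[? ?] ?] [/= -> -> ->]. Qed.
Lemma encNNN_inj : injective encNNN.
Proof. by move=> [[? ?] ?] [[? ?] ?] [/= -> -> ->]. Qed.
Lemma encNVNN_inj : injective encNVNN.
Proof. by move=> [[[? ?] ?] ?] [[[? ?] ?] ?] [/= -> -> -> ->]. Qed.

Lemma encV_sorted a : wellsorted [:: true] a = [exists u, encV u == a].
Proof.
apply/idP/existsP => [|[u /eqP<-]//].
by case: a => [|[x|?] [|? ?]] // _; exists x.
Qed.
Lemma encVV_sorted a : wellsorted [:: true; true] a = [exists u, encVV u == a].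
Proof.
apply/idP/existsP => [|[u /eqP<-]//].
by case: a => [|[x|?] [|[y|?] [|? ?]]] // _; exists (x, y).
Qed.
Lemma encNVV_sorted a :
  wellsorted [:: false; true; true] a = [exists u, encNVV u == a].
Proof.
apply/idP/existsP => [|[u /eqP<-]//].
by case: a => [|[?|i] [|[x|?] [|[y|?] [|? ?]]]] // _; exists (i, x, y).
Qed.
Lemma encNNN_sorted a :
  wellsorted [:: false; false; false] a = [exists u, encNNN u == a].
Proof.
apply/idP/existsP => [|[u /eqP<-]//].
by case: a => [|[?|i] [|[?|j] [|[?|k] [|? ?]]]] // _; exists (i, j, k).
Qed.
Lemma encNVNN_sorted a :
  wellsorted [:: false; true; false; false] a = [exists u, encNVNN u == a].
Proof.
apply/idP/existsP => [|[u /eqP<-]//].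
by case: a => [|[?|i] [|[x|?] [|[?|j] [|[?|k] [|? ?]]]]] // _; exists (i, x, j, k).
Qed.

End Sem.

(** An element of [P] with the fewest predecessors in [P] is minimal: by transitivity, a predecessor
    would have fewer still. *)
Lemma exists_minimal (T : finType) (P : pred T) (lt : rel T) x :
    irreflexive lt -> transitive lt -> P x ->
  exists2 y, P y & forall z, P z -> ~~ lt z y.
Proof.
move=> irr tr Px; pose pre y := [set z | P z & lt z y].
case: (arg_minnP (fun y => #|pre y|) Px) => y Py min_y; exists y => // z Pz.
apply/negP=> lt_zy; have := min_y z Pz; rewrite leqNgt => /negP[].
apply: proper_card; apply/properP; split; last by exists z; rewrite inE Pz ?lt_zy ?irr.
by apply/subsetP=> w; rewrite !inE => /andP[-> /tr-> //].
Qed.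

(** * Modules *)

Section Modules.
Variables (V : finType) (e : rel V).
Hypothesis e_sym : symmetric e.
Implicit Types (B S : {set V}).

Definition is_module B S :=
  S \subset B /\ forall p q z, p \in S -> q \in S -> z \in B -> e p z != e q z -> z \in S.

(** A vertex of [B] that tells two elements of a set apart is a splitter of the set; a module must
    contain all splitters of its subsets. *)
Definition split_step B x y S : {set V} :=
  [set z | [|| z == x, z == y | (z \in B) &&
     [exists p, exists q, [&& p \in S, q \in S & e p z != e q z]]]].

Definition mclos B x y := ifp (split_step B x y).

Definition child B x y :=
  (x == y) || [exists z, [&& z \in B, z \notin mclos B x y & y \in mclos B x z]].

Section Class.
Variable B : {set V}.

Lemma mclos_min S x y : is_module B S -> x \in S -> y \in S -> mclos B x y \subset S.
Proof.
case=> _ modS xS yS; apply: ifp_min => X /subsetP sXS; apply/subsetP=> z.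
rewrite inE => /or3P[/eqP->|/eqP->|] //.
case/andP=> zB /existsP[p /existsP[q /and3P[pX qX neq]]].
exact: (modS p q z (sXS _ pX) (sXS _ qX)).
Qed.

Lemma mclosP x y z : z \in split_step B x y (mclos B x y) -> z \in mclos B x y.
Proof. exact: (subsetP (ifp_closed _)). Qed.

Lemma mclos_l x y : x \in mclos B x y.
Proof. by apply: mclosP; rewrite inE eqxx. Qed.

Lemma mclos_r x y : y \in mclos B x y.
Proof. by apply: mclosP; rewrite inE eqxx orbT. Qed.

Lemma mclos_module x y : x \in B -> y \in B -> is_module B (mclos B x y).
Proof.
move=> xB yB; split.
  apply: ifp_min => X _; apply/subsetP=> z; rewrite inE.
  by case/or3P=> [/eqP->|/eqP->|/andP[]].
move=> p q z pM qM zB neq; apply: mclosP; rewrite inE zB; apply/or3P/Or33.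
by apply/existsP; exists p; apply/existsP; exists q; rewrite pM qM.
Qed.

Lemma mclosC x y : x \in B -> y \in B -> mclos B x y = mclos B y x.
Proof.
by move=> xB yB; apply/eqP; rewrite eqEsubset !mclos_min ?mclos_l ?mclos_r //;
  apply: mclos_module.
Qed.

Lemma module_const S p q z : is_module B S -> p \in S -> q \in S -> z \in B ->
  z \notin S -> e p z = e q z.
Proof.
by move=> [_ modS] pS qS zB; apply: contraNeq; apply: modS.
Qed.

Lemma moduleU S1 S2 x : is_module B S1 -> is_module B S2 -> x \in S1 -> x \in S2 ->
  is_module B (S1 :|: S2).
Proof.
move=> mod1 mod2 x1 x2; split; first by rewrite subUset mod1.1 mod2.1.
move=> p q z pU qU zB; apply: contraNT; rewrite inE negb_or => /andP[z1 z2].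
have const r : r \in S1 :|: S2 -> e r z = e x z.
  by case/setUP=> rS; [apply: (module_const mod1) | apply: (module_const mod2)].
by rewrite !const.
Qed.

Lemma module1 x : x \in B -> is_module B [set x].
Proof.
move=> xB; split; first by rewrite sub1set.
by move=> p q z /set1P-> /set1P->; rewrite eqxx.
Qed.

(** * Components of the graph on [B] and of its complement *)

(* [c] selects the graph or its complement. *)
Definition link (c : bool) u v := [&& u \in B, v \in B, u != v & e u v == c].

Lemma link_sym c : symmetric (link c).
Proof. by move=> u v; rewrite /link e_sym eq_sym; case: (u \in B); rewrite ?andbF. Qed.

Lemma connect_link_sym c : connect_sym (link c).
Proof. by apply: sym_connect_sym; apply: link_sym. Qed.

Lemma connect_link_sub c x y : x \in B -> connect (link c) x y -> y \in B.
Proof.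
move=> xB /connectP[p px ->]; elim: p x xB px => //= z p IHp x xB /andP[xz].
by apply: IHp; case/and4P: xz.
Qed.

Lemma not_connect_edge c x y : x \in B -> y \in B -> ~~ connect (link c) x y ->
  e x y = ~~ c.
Proof.
move=> xB yB; apply: contraNeq => neq; have [->//|xy] := eqVneq x y.
apply: connect1; rewrite /link xB yB xy /=.
by move: neq; case: c (e x y) => [] [].
Qed.

Lemma component_module c x : x \in B -> is_module B [set z | connect (link c) x z].
Proof.
move=> xB; split.
  by apply/subsetP=> z; rewrite inE; apply: connect_link_sub.
move=> p q z; rewrite !inE => xp xq zB; apply: contraNT => nxz.
have out r : connect (link c) x r -> e r z = ~~ c.
  move=> xr; apply: not_connect_edge => //; first exact: connect_link_sub xr.
  by apply: contra nxz; apply: connect_trans.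
by rewrite !out.
Qed.

Lemma component2_module c x y : x \in B -> y \in B ->
  is_module B [set z | connect (link c) x z || connect (link c) y z].
Proof.
move=> xB yB; split.
  by apply/subsetP=> z; rewrite inE => /orP[]; apply: connect_link_sub.
move=> p q z; rewrite !inE => xp xq zB; apply: contraNT => /norP[nxz nyz].
have out r : connect (link c) x r || connect (link c) y r -> e r z = ~~ c.
  case/orP=> xr; (apply: not_connect_edge => //; first exact: connect_link_sub xr).
    by apply: contra nxz; apply: connect_trans.
  by apply: contra nyz; apply: connect_trans.
by rewrite !out.
Qed.

(** On a [link c] path from [x], the next vertex [w] has adjacency [c] to its predecessor but [~~ c]
    to [y], which is in another component. So [w] splits two vertices of the closure and enters
    it. *)
Lemma component_sub_mclos c x y z : x \in B -> y \in B -> ~~ connect (link c) x y ->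
  connect (link c) x z -> z \in mclos B x y.
Proof.
move=> xB yB nxy xz.
have [_ modM] := mclos_module xB yB.
have main p u : u \in mclos B x y -> connect (link c) x u -> path (link c) u p ->
    last u p \in mclos B x y.
  elim: p u => //= w p IHp u uM xu /andP[uw pw].
  have xw := connect_trans xu (connect1 uw).
  apply: IHp => //; apply: (modM u y w) => //; first exact: mclos_r.
    by case/and4P: uw.
  have nyw : ~~ connect (link c) y w.
    by apply: contra nxy => yw; apply: connect_trans xw _; rewrite connect_link_sym.
  have wB : w \in B by case/and4P: uw.
  rewrite (not_connect_edge yB wB nyw); case/and4P: uw => _ _ _ /eqP->.
  by case: (c).
have [p xp ->] := connectP xz; apply: main => //; exact: mclos_l.
Qed.

Definition disconnected c := [exists x in B, exists y in B, ~~ connect (link c) x y].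

Lemma child_disconnected c x y : disconnected c -> x \in B -> y \in B ->
  child B x y = connect (link c) x y.
Proof.
case/exists_inP=> a aB /exists_inP[b bB nab] xB yB.
apply/orP/idP => [[/eqP->//|/existsP[z /and3P[zB zM yM]]]|xy].
  apply: contraNT zM => nxy; have := subsetP (mclos_min (component2_module c xB zB) _ _) y yM.
  rewrite !inE connect0 connect0 orbT => /(_ isT isT).
  rewrite (negPf nxy) /= => zy; rewrite mclosC //.
  apply: (@component_sub_mclos c) => //; first by rewrite connect_link_sym.
  by rewrite connect_link_sym.
(* Any [z] in another component is a witness: the closure of [x] and [y] stays in the component of
   [x], while that of [x] and [z] swallows it. *)
right; have [z zB nxz] : exists2 z, z \in B & ~~ connect (link c) x z.
  have [xa|] := boolP (connect (link c) x a); last by exists a.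
  exists b => //; apply: contra nab; apply: connect_trans.
  by rewrite connect_link_sym.
apply/existsP; exists z; rewrite zB /=; apply/andP; split.
  apply: contra nxz => zM.
  have := subsetP (mclos_min (component_module c xB) _ _) z zM.
  by rewrite !inE; apply; rewrite ?connect0.
exact: component_sub_mclos xy.
Qed.

(** * Modules when the graph on [B] and its complement are both connected *)

Hypothesis conn : forall c, ~~ disconnected c.

(** If the two modules covered [B], all pairs between [S1] and the rest of [B] would have the same
    adjacency [c], and no [link (~~ c)] path could enter [S1] from outside. *)
Lemma proper_moduleU S1 S2 x : is_module B S1 -> is_module B S2 ->
  x \in S1 -> x \in S2 -> S1 != B -> S2 != B -> S1 :|: S2 != B.
Proof.
move=> mod1 mod2 x1 x2 neq1 neq2; apply/eqP=> eqU.
have xB : x \in B by apply: (subsetP mod1.1).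
have [p pB p1] : exists2 p, p \in B & p \notin S1.
  by apply/subsetPn; apply: contra neq1 => sB; rewrite eqEsubset mod1.1.
have [q qB q2] : exists2 q, q \in B & q \notin S2.
  by apply/subsetPn; apply: contra neq2 => sB; rewrite eqEsubset mod2.1.
have cases z : z \in B -> (z \in S1) || (z \in S2) by rewrite -eqU inE.
have p2 : p \in S2 by have := cases p pB; rewrite (negPf p1).
have q1 : q \in S1 by have := cases q qB; rewrite (negPf q2) orbF.
pose c := e p q.
have cross u v : u \in B -> v \in B -> u \notin S1 -> v \in S1 -> e u v = c.
  move=> uB vB u1 v1.
  have u2 : u \in S2 by have := cases u uB; rewrite (negPf u1).
  (* Move [v] to [q] within [S1], then [u] to [p] within [S2]. *)
  rewrite e_sym (module_const mod1 v1 q1 uB u1) e_sym.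
  by rewrite (module_const mod2 u2 p2 qB q2).
have stay s u : u \notin S1 -> path (link (~~ c)) u s -> last u s \notin S1.
  elim: s u => //= w s IHs u u1 /andP[/and4P[uB wB _ /eqP uw]]; apply: IHs.
  apply/negP=> w1; have := cross u w uB wB u1 w1; rewrite uw.
  by case: (c).
have /negP[] := conn (~~ c); apply/exists_inP; exists p => //; apply/exists_inP; exists q => //.
apply/connectP=> -[s ps qs]; have := stay s p p1 ps.
by rewrite -qs q1.
Qed.

(** A largest proper module above [S] works: were the closure of [x] inside and [y] outside proper,
    its union with [M] would be a larger proper module. *)
Lemma maximal_proper_module S : is_module B S -> S != B -> S != set0 ->
  exists M, [/\ is_module B M, M != B, S \subset M &
    forall x y, x \in M -> y \in B -> y \notin M -> mclos B x y = B].
Proof.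
move=> modS neqS /set0Pn[a aS].
pose P (M : {set V}) := [&& M != B, S \subset M &
  (M \subset B) && [forall p in M, forall q in M, forall z in B, (e p z != e q z) ==> (z \in M)]].
have modP M : reflect [/\ is_module B M, M != B & S \subset M] (P M).
  apply: (iffP and3P) => [[neqM sSM /andP[sMB modM]]|[[sMB modM] neqM sSM]].
    split=> //; split=> // p q z pM qM zB.
    by move/forall_inP: modM => /(_ p pM)/forall_inP/(_ q qM)/forall_inP/(_ z zB)/implyP.
  split=> //; rewrite sMB; do 3!(apply/forall_inP=> ? ?); apply/implyP; exact: modM.
have PS : P S by apply/modP.
have [M /modP[modM neqM sSM] maxM] := arg_maxnP (fun M : {set V} => #|M|) PS.
exists M; split=> // x y xM yB yM; apply/eqP/negPn/negP => neq_xy.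
have xB := subsetP modM.1 x xM.
have mod_xy := mclos_module xB yB.
have : P (M :|: mclos B x y).
  apply/modP; split; [apply: moduleU (xM) (mclos_l x y) | | apply: subset_trans (subsetUl _ _)] => //.
  exact: proper_moduleU (xM) (mclos_l x y) neqM neq_xy.
move/maxM; rewrite /= leqNgt => /negP[]; apply: proper_card; rewrite properE subsetUl /=.
by apply/subsetPn; exists y; rewrite // inE mclos_r orbT.
Qed.

Lemma child_connected x y : x \in B -> y \in B ->
  child B x y = (x == y) || (mclos B x y != B).
Proof.
move=> xB yB; congr (_ || _); apply/existsP/idP => [[z /and3P[zB zM _]]|neq].
  by apply: contra zM => /eqP->.
have mod_xy := mclos_module xB yB.
have [|M [modM neqM sub maxM]] := maximal_proper_module mod_xy neq.
  by apply/set0Pn; exists x; apply: mclos_l.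
have [z zB zM] : exists2 z, z \in B & z \notin M.
  by apply/subsetPn; apply: contra neqM => sB; rewrite eqEsubset modM.1.
exists z; rewrite zB (maxM x z) ?yB ?andbT //; last by rewrite (subsetP sub) ?mclos_l.
by apply: contra zM; apply: (subsetP sub).
Qed.

End Class.

(** * The partition of a set into its parts, in both cases *)

Section Child.
Variable B : {set V}.

Lemma connectedP : (exists c, disconnected B c) \/ (forall c, ~~ disconnected B c).
Proof.
have [|n1] := boolP (disconnected B true); first by left; exists true.
have [|n2] := boolP (disconnected B false); first by left; exists false.
by right; case.
Qed.

Lemma child_refl x : child B x x.
Proof. by rewrite /child eqxx. Qed.

Lemma child_sym x y : x \in B -> y \in B -> child B x y = child B y x.
Proof.
move=> xB yB; have [[c disc]|conn] := connectedP.
  by rewrite !(child_disconnected disc) // connect_link_sym.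
by rewrite !child_connected // eq_sym mclosC.
Qed.

(** In the connected case the two proper closures share [y], so their union is a proper module that
    contains [x] and [z]. *)
Lemma child_trans x y z : x \in B -> y \in B -> z \in B ->
  child B x y -> child B y z -> child B x z.
Proof.
move=> xB yB zB; have [[c disc]|conn] := connectedP.
  by rewrite !(child_disconnected disc) //; apply: connect_trans.
rewrite !child_connected // => /orP[/eqP->//|neq_xy] /orP[/eqP<-|neq_yz].
  by rewrite neq_xy orbT.
have mod_xy := mclos_module xB yB; have mod_yz := mclos_module yB zB.
have := proper_moduleU conn mod_xy mod_yz (mclos_r _ x y) (mclos_l _ y z) neq_xy neq_yz.
move=> neqU; apply/orP; right; apply: contra neqU => /eqP eq_xz.
have modU := moduleU mod_xy mod_yz (mclos_r _ x y) (mclos_l _ y z).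
rewrite eqEsubset modU.1 -{1}eq_xz mclos_min // inE ?mclos_l // mclos_r orbT //.
Qed.

Lemma child_module x x' y : x \in B -> x' \in B -> y \in B ->
  child B x x' -> ~~ child B x y -> e x y = e x' y.
Proof.
move=> xB x'B yB; have [[c disc]|conn] := connectedP.
  rewrite !(child_disconnected disc) // => xx' nxy.
  rewrite !(@not_connect_edge B c) //; apply: contra nxy; exact: connect_trans.
rewrite !child_connected // => /orP[/eqP->//|neq] /norP[_ /negPn/eqP eq_xy].
have mod' := mclos_module xB x'B.
apply: (module_const mod'); rewrite ?mclos_l ?mclos_r //.
apply: contra neq => y_in; rewrite eqEsubset mod'.1 -{1}eq_xy.
by apply: mclos_min => //; apply: mclos_l.
Qed.

(** This is the progress of the decomposition, used to see that repeated refinement ends in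
    singletons. *)
Lemma child_split : 1 < #|B| -> exists x y, [/\ x \in B, y \in B & ~~ child B x y].
Proof.
case/card_gt1P=> a [b [aB bB neq_ab]]; have [[c disc]|conn] := connectedP.
  have /exists_inP[x xB /exists_inP[y yB nxy]] := disc.
  by exists x, y; rewrite (child_disconnected disc).
have neqB : [set a] != B.
  by apply/eqP=> eqB; move: bB; rewrite -eqB inE eq_sym (negPf neq_ab).
have [|M [modM neqM sub maxM]] := maximal_proper_module conn (module1 aB) neqB.
  by apply/set0Pn; exists a; rewrite inE.
have [z zB zM] : exists2 z, z \in B & z \notin M.
  by apply/subsetPn; apply: contra neqM => sB; rewrite eqEsubset modM.1.
have aM : a \in M by rewrite (subsetP sub) ?inE.
exists a, z; rewrite child_connected // (maxM a z) // eqxx orbF; split=> //.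
by apply: contraNneq zM => <-.
Qed.

Definition crossing (c : bool) :=
  [exists u, exists v, [&& u \in B, v \in B, ~~ child B u v & e u v == c]].

(** The quotient by the parts is complete or edgeless, a single part included; the remaining case is
    the prime quotient of Gallai's modular decomposition. *)
Definition degenerate := ~~ (crossing true && crossing false).

Lemma nondegenerate_mclos x y : ~~ degenerate -> x \in B -> y \in B ->
  ~~ child B x y -> mclos B x y = B.
Proof.
move/negPn=> /andP[cr1 cr2] xB yB; have [[c disc]|conn] := connectedP; last first.
  by rewrite child_connected // => /norP[_ /negPn/eqP].
(* Distinct components of [link c] see each other with adjacency [~~ c] only, so a crossing pair of
   adjacency [c] contradicts disconnection. *)
have : crossing c by case: (c).
case/existsP=> u /existsP[v /and4P[uB vB]]; rewrite (child_disconnected disc) //.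
by move=> nuv; rewrite (not_connect_edge _ _ nuv) //; case: (c).
Qed.

Lemma crossing_unique x y : degenerate -> x \in B -> y \in B -> ~~ child B x y ->
  e x y = crossing true.
Proof.
move=> deg xB yB nxy.
have : crossing (e x y).
  by apply/existsP; exists x; apply/existsP; exists y; rewrite xB yB nxy /=.
case exy: (e x y) => cr; rewrite ?cr //.
by move: deg; rewrite /degenerate cr andbT => /negPf->.
Qed.

End Child.
End Modules.

(** * The decomposition by levels *)

Section Levels.
Variables (V : finType) (e : rel V).
Hypothesis e_sym : symmetric e.

Definition class (R : rel V) x := [set y | R x y].

Definition refine (R : rel V) : rel V := fun x y => R x y && child e (class R x) x y.

Definition level d : rel V := iter d refine (fun _ _ => true).

Lemma refine_equiv (R : rel V) : equivalence_rel R -> equivalence_rel (refine R).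
Proof.
move=> eqR x y z.
have Rxx u : R u u by have [] := eqR u u u.
have classE u v : R u v -> class R u = class R v.
  by move=> uv; apply/setP=> w; rewrite !inE; have [_ ->] := eqR u v w.
split; first by rewrite /refine Rxx child_refl.
case/andP=> xy; have yx : R y x by have [_ <-] := eqR x y x.
rewrite /refine (classE _ _ xy) => ch_xy; have [_ ->//] := eqR x y z.
case yz: (R y z) => //=.
have [xB yB zB] : [/\ x \in class R y, y \in class R y & z \in class R y] by rewrite !inE.
apply/idP/idP; apply: child_trans => //.
by rewrite child_sym.
Qed.

Lemma level_equiv d : equivalence_rel (level d).
Proof. by elim: d => [|d IHd] //; apply: refine_equiv. Qed.

Lemma level_refl d x : level d x x.
Proof. by have [] := level_equiv d x x x. Qed.

Lemma level_trans d : transitive (level d).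
Proof. by move=> y x z xy; have [_ ->] := level_equiv d x y z. Qed.

Lemma level_class d x y : level d x y -> class (level d) x = class (level d) y.
Proof. by move=> xy; apply/setP=> z; rewrite !inE; have [_ ->] := level_equiv d x y z. Qed.

Lemma level_child d x y : level d x y ->
  level d.+1 x y = child e (class (level d) x) x y.
Proof. by rewrite /level iterS -/(level d) /refine => ->. Qed.

Lemma level_classS_sub d x : class (level d.+1) x \subset class (level d) x.
Proof. by apply/subsetP=> y; rewrite !inE => /andP[]. Qed.

(** [k.-1.+1] is the maximum of [k] and 1: each refinement removes a vertex from every class that is
    not yet a singleton. *)
Lemma card_level_class d x : #|class (level d) x| <= (#|V| - d).-1.+1.
Proof.
elim: d => [|d IHd]; first by rewrite subn0 (leq_trans (max_card _)) // leqSpred.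
have sub := subset_leq_card (level_classS_sub d x).
have [le1|gt1] := leqP #|class (level d) x| 1; first exact: leq_trans sub (leq_trans le1 _).
have [y [z [yB zB nyz]]] := child_split e_sym gt1.
have : #|class (level d.+1) x| < #|class (level d) x|.
  apply: proper_card; rewrite properE level_classS_sub; apply/subsetPn.
  have xB : x \in class (level d) x by rewrite inE level_refl.
  have in_class u : u \in class (level d) x ->
      (u \in class (level d.+1) x) = child e (class (level d) x) x u.
    by rewrite inE => xu; rewrite inE level_child.
  have [xy|nxy] := boolP (child e (class (level d) x) x y); last by exists y; rewrite ?in_class.
  exists z; rewrite ?in_class //; apply: contra nyz => xz.
  by apply: child_trans xz => //; rewrite child_sym.
by move/leq_trans/(_ IHd); lia.
Qed.

End Levels.

(** * Orders forced by a first class *)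

Section Forced.
Variables (V : finType) (e : rel V).
Hypothesis e_sym : symmetric e.

(* If [X] is a partial <1 then [flip X] is the corresponding partial <2. *)
Definition flip (X : {set V * V}) u v := if e u v then (v, u) \in X else (u, v) \in X.

Definition flip2 X u v := [exists z, flip X u z && flip X z v].

(** The last clause is transitivity of <2 read back as a statement on <1; the reversal for an edge
    is there because the two orders disagree on edges. *)
Definition forced_step (B : {set V}) (Q : rel V) a (X : {set V * V}) : {set V * V} :=
  [set u | [|| [&& u.1 \in B, u.2 \in B, Q a u.1 & ~~ Q a u.2],
     [exists z, ((u.1, z) \in X) && ((z, u.2) \in X)] |
     if e u.1 u.2 then flip2 X u.2 u.1 else flip2 X u.1 u.2]].

(* The part of <1 on the quotient of [B] by [Q] that is forced once the class
   of [a] comes first. *)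
Definition forced (B : {set V}) (Q : rel V) a : rel V := fun x y => (x, y) \in ifp (forced_step B Q a).

(** The closure is a strict linear order on the parts, that is, incomparability is exactly [Q]. No
    realizer is mentioned, so a formula can test it. *)
Definition valid (B : {set V}) (Q : rel V) a :=
  [forall x, forall y, (x \in B) && (y \in B) ==>
    (Q x y == ~~ forced B Q a x y && ~~ forced B Q a y x) &&
    ~~ (forced B Q a x y && forced B Q a y x)].

Variables (B : {set V}) (Q : rel V).
Hypothesis Q_child : {in B &, Q =2 child e B}.
Hypothesis Q_sub : forall x y, x \in B -> Q x y -> y \in B.

Lemma forcedP a x y :
  (x, y) \in forced_step B Q a (ifp (forced_step B Q a)) -> forced B Q a x y.
Proof. exact: (subsetP (ifp_closed _)). Qed.

Lemma forced_seed a x y : x \in B -> y \in B -> Q a x -> ~~ Q a y -> forced B Q a x y.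
Proof. by move=> xB yB ax nay; apply: forcedP; rewrite inE /= xB yB ax nay. Qed.

Lemma forced_trans a : transitive (forced B Q a).
Proof.
move=> y x z xy yz; apply: forcedP; rewrite inE /=; apply/or3P/Or32.
by apply/existsP; exists y; apply/andP.
Qed.

Let flipF a := flip (ifp (forced_step B Q a)).

Lemma flipE a x y : flipF a x y = if e x y then forced B Q a y x else forced B Q a x y.
Proof. by []. Qed.

Lemma flip_trans a : transitive (flipF a).
Proof.
move=> y x z xy yz; have xz : flip2 (ifp (forced_step B Q a)) x z.
  by apply/existsP; exists y; apply/andP.
rewrite flipE; case exz: (e x z); apply: forcedP; rewrite inE /=; apply/or3P/Or33.
  by rewrite e_sym exz.
by rewrite exz.
Qed.

Section Sound.
Variables (lt1 lt2 : rel V) (real : realizer e lt1 lt2).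

(** A realizer may interleave the parts. One vertex from each part spans a copy of the quotient, and
    the realizer restricts to it. *)
Let rep x := odflt x [pick y in B | Q x y].

Lemma Q_rep x : x \in B -> (rep x \in B) /\ Q x (rep x).
Proof.
move=> xB; rewrite /rep; case: pickP => [y /andP[]|none] //=.
by split=> //; rewrite Q_child // child_refl.
Qed.

Lemma Q_sym x y : x \in B -> y \in B -> Q x y = Q y x.
Proof. by move=> xB yB; rewrite !Q_child // child_sym. Qed.

Lemma Q_trans x y z : x \in B -> Q x y -> Q y z -> Q x z.
Proof.
move=> xB xy yz; have yB := Q_sub xB xy; have zB := Q_sub yB yz.
by move: xy yz; rewrite !Q_child //; apply: child_trans.
Qed.

Lemma rep_eq x y : x \in B -> y \in B -> (rep x == rep y) = Q x y.
Proof.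
move=> xB yB; apply/eqP/idP=> [eq_r|xy].
  have [_ xr] := Q_rep xB; have [rB yr] := Q_rep yB.
  by apply: Q_trans xr _ => //; rewrite eq_r Q_sym.
have eqQ : [pred z in B | Q x z] =1 [pred z in B | Q y z].
  move=> z /=; case zB: (z \in B) => //=.
  by apply/idP/idP; apply: Q_trans => //; rewrite Q_sym.
rewrite /rep (eq_pick eqQ); case: pickP => // /(_ y) /=.
by rewrite yB Q_child // child_refl.
Qed.

Lemma edge_rep x y : x \in B -> y \in B -> ~~ Q x y -> e x y = e (rep x) (rep y).
Proof.
move=> xB yB nxy; have [rxB xr] := Q_rep xB; have [ryB yr] := Q_rep yB.
rewrite Q_child // in xr; rewrite Q_child // in yr; rewrite Q_child // in nxy.
rewrite (child_module e_sym xB rxB yB xr nxy) ![e (rep x) _]e_sym.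
apply: (child_module e_sym yB ryB rxB yr).
apply: contra nxy => yrx; rewrite child_sym //.
by apply: child_trans yrx _ => //; rewrite child_sym.
Qed.

Variable a : V.
Hypotheses (aB : a \in B)
  (a_first : forall y, y \in B -> ~~ Q a y -> lt1 (rep a) (rep y)).

(** Every clause of the closure is true of the order that [lt1] puts on the representatives, given
    that the part of [a] comes first; so no stage leaves this order. *)
Lemma forced_sound x y : forced B Q a x y ->
  [/\ x \in B, y \in B, ~~ Q x y & lt1 (rep x) (rep y)].
Proof.
have [[irr1 [tr1 tot1]] [[irr2 [tr2 tot2]] edgeE]] := real.
have asym1 u v : lt1 u v -> lt1 v u -> false by move=> uv /(tr1 _ _ _ uv); rewrite irr1.
have asym2 u v : lt2 u v -> lt2 v u -> false by move=> uv /(tr2 _ _ _ uv); rewrite irr2.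
pose S := [set u : V * V | [&& u.1 \in B, u.2 \in B, ~~ Q u.1 u.2 & lt1 (rep u.1) (rep u.2)]].
suff sFS : ifp (forced_step B Q a) \subset S.
  by move/(subsetP sFS); rewrite inE => /and4P.
have nQ lt u v : irreflexive lt -> u \in B -> v \in B -> lt (rep u) (rep v) -> ~~ Q u v.
  move=> irr uB vB; apply: contraL => uv.
  have /eqP-> : rep u == rep v by rewrite rep_eq.
  by rewrite irr.
apply: ifp_min => X /subsetP sXS; apply/subsetP=> -[{}x {}y]; rewrite !inE /=.
have XS u v : (u, v) \in X -> [/\ u \in B, v \in B, ~~ Q u v & lt1 (rep u) (rep v)].
  by move/sXS; rewrite inE => /and4P.
have flipS u v : flip X u v -> [/\ u \in B, v \in B & lt2 (rep u) (rep v)].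
  have main u' v' : (u', v') \in X -> lt1 (rep u') (rep v') ->
      lt2 (rep u') (rep v') = ~~ e u' v' /\ lt2 (rep v') (rep u') = e u' v'.
    case/XS=> uB vB nuv lt_uv _; have neq : rep u' != rep v' by rewrite rep_eq.
    rewrite (edge_rep uB vB nuv) (edgeE _ _ neq) lt_uv.
    have := tot2 _ _ neq; case l: (lt2 (rep u') (rep v')) => /=.
      by split=> //; apply/negP=> /(asym2 _ _ l).
    by move=> ->.
  rewrite /flip; case euv: (e u v) => inX; have [uB vB _ lt_uv] := XS _ _ inX.
    by have [_ ->] := main _ _ inX lt_uv; rewrite e_sym euv.
  by have [-> _] := main _ _ inX lt_uv; rewrite euv.
have flip2S u v : flip2 X u v -> [/\ u \in B, v \in B & lt2 (rep u) (rep v)].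
  case/existsP=> z /andP[/flipS[uB zB uz] /flipS[_ vB zv]].
  by split=> //; apply: tr2 uz zv.
have back u v : u \in B -> v \in B -> lt2 (rep u) (rep v) -> e u v -> lt1 (rep v) (rep u).
  move=> uB vB lt_uv euv; have nuv := nQ _ _ _ irr2 uB vB lt_uv.
  have neq : rep u != rep v by rewrite rep_eq.
  move: euv; rewrite (edge_rep uB vB nuv) (edgeE _ _ neq) lt_uv.
  by have := tot1 _ _ neq; case: (lt1 (rep u) (rep v)).
case/or3P=> [/and4P[xB yB ax nay]|/existsP[z /andP[/XS[xB zB nxz xz] /XS[_ yB _ zy]]]|].
- have lt_xy : lt1 (rep x) (rep y).
    by have /eqP-> : rep x == rep a; [rewrite rep_eq // Q_sym | apply: a_first].
  by rewrite xB yB lt_xy (nQ lt1).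
- have lt_xy := tr1 _ _ _ xz zy.
  by rewrite xB yB lt_xy (nQ lt1).
case exy: (e x y) => /flip2S[uB vB lt2_uv].
  have lt_xy := back _ _ uB vB lt2_uv; rewrite e_sym exy in lt_xy.
  by rewrite uB vB lt_xy //= andbT (nQ lt1) // lt_xy.
have nxy := nQ _ _ _ irr2 uB vB lt2_uv; rewrite uB vB nxy /=.
have neq : rep x != rep y by rewrite rep_eq.
have := edgeE _ _ neq; rewrite -(edge_rep uB vB nxy) exy lt2_uv.
by case: (lt1 _ _).
Qed.

Let related x y := forced B Q a x y || forced B Q a y x.

Lemma relatedC x y : related x y = related y x.
Proof. exact: orbC. Qed.

Lemma relatedE x y : related x y = flipF a x y || flipF a y x.
Proof. by rewrite !flipE [e y x]e_sym; case: (e x y); rewrite // orbC. Qed.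

(* Let [K] be minimal among the sets that contain the unrelated elements x, y
   and whose elements are all related to every element outside.  If some z
   outside split [K], one of the parts of [K] before and after z, or adjacent
   and nonadjacent to z, would be a smaller such set. *)
Lemma forced_total x y : ~~ degenerate e B -> x \in B -> y \in B -> ~~ Q x y -> related x y.
Proof.
move=> ndeg xB yB nxy; apply/negPn/negP => unrel.
pose cut (K : {set V}) := [forall k in K, forall z in B, (z \notin K) ==> related k z].
have cutP (K : {set V}) : reflect (forall k z, k \in K -> z \in B -> z \notin K -> related k z) (cut K).
  apply: (iffP forall_inP) => [cutK k z kK zB|cutK k kK]; last first.
    by apply/forall_inP=> z zB; apply/implyP; apply: cutK.
  by move/forall_inP: (cutK k kK) => /(_ z zB)/implyP.
pose P (K : {set V}) := [&& K \subset B, x \in K, y \in K & cut K].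
have PB : P B.
  by rewrite /P subxx xB yB; apply/cutP=> k z _ ->.
have [K /and4P[sKB xK yK /cutP cutK] minK] := arg_minnP (fun K : {set V} => #|K|) PB.
have min_sub (L : {set V}) : (forall k z, k \in K -> z \in K -> k \in L -> z \notin L -> related k z) ->
    x \in L -> y \in L -> K \subset L.
  move=> cutL xL yL.
  have PL : P (K :&: L).
    rewrite /P !inE xK xL yK yL subIset ?sKB //=; apply/cutP=> k z.
    rewrite !inE => /andP[kK kL] zB; rewrite negb_and.
    have [zK /=|zK _] := boolP (z \in K); [exact: cutL | exact: cutK].
  apply/setIidPl/eqP; rewrite eqEcard subsetIl; exact: minK PL.
(* Such an [L] contains all of [K] or nothing of it: [x] and [y], being unrelated, are on the same
   side, and that side would otherwise be a smaller choice of [K]. *)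
have min_split (L : {set V}) :
    (forall k z, k \in K -> z \in K -> k \in L -> z \notin L -> related k z) ->
    forall p q, p \in K -> q \in K -> (p \in L) = (q \in L).
  move=> cutL p q pK qK.
  have cutL' k z : k \in K -> z \in K -> k \in ~: L -> z \notin ~: L -> related k z.
    by rewrite !inE negbK relatedC => kK zK kL zL; apply: cutL.
  have [xL|xL] := boolP (x \in L).
    have [yL|yL] := boolP (y \in L); last by case/negP: unrel; apply: cutL.
    by have /subsetP sKL := min_sub L cutL xL yL; rewrite !sKL.
  have [yL|yL] := boolP (y \in L); first by case/negP: unrel; rewrite relatedC; apply: cutL.
  have /subsetP sKL : K \subset ~: L by apply: min_sub; rewrite ?inE.
  by have := sKL p pK; have := sKL q qK; rewrite !inE => /negPf-> /negPf->.
(* The seed relates the class of [a] to all other vertices of [B]; with [a] in [K], all of [K] would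
   be in that class, against [~~ Q x y]. *)
have aK : a \notin K.
  have not_class k z : k \in K -> z \in K -> k \in [set u | Q a u] -> z \notin [set u | Q a u] ->
      related k z.
    rewrite !inE => kK zK ak naz; apply/orP; left.
    by apply: forced_seed => //; apply: (subsetP sKB).
  apply/negP=> aK; have [_ aa] := Q_rep aB.
  have := min_split _ not_class a x aK xK; rewrite !inE Q_child // child_refl => /esym ax.
  have := min_split _ not_class a y aK yK; rewrite !inE Q_child // child_refl => /esym ay.
  by case/negP: nxy; apply: Q_trans ay => //; rewrite Q_sym.
(* For [z] outside [K], being before [z] is uniform over [K] in each of the two orders, and the two
   answers together determine adjacency to [z]. *)
have modK : is_module e B K.
  split=> // p q z pK qK zB; apply: contraNT => zK; apply/eqP.
  have rel_z k : k \in K -> related k z by move=> kK; apply: cutK.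
  have side_1 : forall p q, p \in K -> q \in K -> forced B Q a p z = forced B Q a q z.
    have := min_split [set k | forced B Q a k z]; rewrite /= => sp u v uK vK.
    have := sp _ u v uK vK; rewrite !inE; apply=> k l kK lK; rewrite !inE => kz nlz.
    have := rel_z l lK; rewrite /related (negPf nlz) /= => zl.
    by rewrite (forced_trans kz zl).
  have side_2 : forall p q, p \in K -> q \in K -> flipF a p z = flipF a q z.
    have := min_split [set k | flipF a k z]; rewrite /= => sp u v uK vK.
    have := sp _ u v uK vK; rewrite !inE; apply=> k l kK lK; rewrite !inE => kz nlz.
    have := rel_z l lK; rewrite relatedE (negPf nlz) /= => zl.
    by rewrite relatedE (flip_trans kz zl).
  have asym u v : forced B Q a u v -> forced B Q a v u = false.
    case/forced_sound=> _ _ _ lt_uv; apply/negP=> /forced_sound[_ _ _].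
    have [[irr1 [tr1 _]] _] := real; move/(tr1 _ _ _ lt_uv); by rewrite irr1.
  move: (side_1 p q pK qK) (side_2 p q pK qK) (rel_z p pK) (rel_z q qK).
  rewrite !flipE /related; case pz: (forced B Q a p z) => /esym qz; rewrite qz /=.
    by rewrite (asym _ _ pz) (asym _ _ qz); case: (e p z) (e q z) => [] [].
  by case: (e p z) (e q z) => [] [] //= => [<-|->].
(* The module [K] contains the closure of [x] and [y], which is all of [B], and yet misses [a]. *)
have := nondegenerate_mclos e_sym ndeg xB yB; rewrite -Q_child // => /(_ nxy) eqB.
by move: (subsetP (mclos_min modK xK yK) a); rewrite eqB aB (negPf aK) => /(_ isT).
Qed.

Lemma valid_first : ~~ degenerate e B -> valid B Q a.
Proof.
move=> ndeg; have [[irr1 [tr1 _]] _] := real.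
apply/forallP=> x; apply/forallP=> y; apply/implyP=> /andP[xB yB].
have asym : ~~ (forced B Q a x y && forced B Q a y x).
  apply/negP=> /andP[/forced_sound[_ _ _ xy] /forced_sound[_ _ _ yx]].
  by have := tr1 _ _ _ xy yx; rewrite irr1.
rewrite asym andbT; apply/eqP.
have [xy|nxy] := boolP (Q x y).
  apply/esym/andP; split; apply/negP=> /forced_sound[_ _]; first by rewrite xy.
  by rewrite Q_sym // xy.
by rewrite -negb_or; apply/esym/negbTE/negPn/forced_total.
Qed.

End Sound.

Lemma valid_exists : permutation_graph e -> ~~ degenerate e B -> B != set0 ->
  exists2 a, a \in B & valid B Q a.
Proof.
case=> lt1 [lt2 real] ndeg /set0Pn[b bB].
have [[irr1 [tr1 tot1]] _] := real.
pose r x := odflt x [pick y in B | Q x y].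
pose lt := fun x y => lt1 (r x) (r y).
have [|||a aB min_a] := @exists_minimal _ (mem B) lt b.
- by move=> x; rewrite /lt irr1.
- by move=> y x z; apply: tr1.
- exact: bB.
exists a => //; apply: (valid_first real aB) => // y yB nay.
have neq : r a != r y by rewrite rep_eq.
by have := tot1 _ _ neq; rewrite -/(lt a y) -/(lt y a) (negPf (min_a _ yB)) orbF.
Qed.

End Forced.

(** * Comparing and assembling ordered copies *)

Section Lex.
Variable n : nat.
Implicit Types f g h : 'I_n -> 'I_n -> bool.

(** Entries are read row by row; at the first difference the smaller matrix has [false]. *)
Definition lex f g := [exists i, exists j, [&& ~~ f i j, g i j &
  [forall i' : 'I_n, forall j' : 'I_n, (i' < i) || (i' == i) && (j' < j) ==> (f i' j' == g i' j')]]].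

Lemma lexP f g : reflect (exists i j : 'I_n, [/\ ~~ f i j, g i j &
    forall i' j' : 'I_n, i' < i \/ i' = i :> nat /\ j' < j -> f i' j' = g i' j']) (lex f g).
Proof.
apply: (iffP existsP) => [[i /existsP[j /and3P[fij gij /forallP eqfg]]]|[i [j [fij gij eqfg]]]].
  exists i, j; split=> // i' j' lt; apply/eqP.
  apply: (implyP (forallP (eqfg i') j')).
  by case: lt => [->//|[/val_inj-> ->]]; rewrite eqxx orbT.
exists i; apply/existsP; exists j; rewrite fij gij; apply/forallP=> i'; apply/forallP=> j'.
by apply/implyP=> /orP[lt|/andP[/eqP-> lt]]; apply/eqP/eqfg; [left | right].
Qed.

Lemma lex_irr : irreflexive lex.
Proof. by move=> f; apply/lexP=> -[i [j [/negPf->]]]. Qed.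

Lemma lex_eq f f' g g' : f =2 f' -> g =2 g' -> lex f g = lex f' g'.
Proof.
move=> eqf eqg; apply: eq_existsb => i; apply: eq_existsb => j; rewrite eqf eqg.
by congr [&& _, _ & _]; apply: eq_forallb => i'; apply: eq_forallb => j'; rewrite eqf eqg.
Qed.

Let ord_cmp (i j i' j' : 'I_n) : [\/ i < i' \/ i = i' :> nat /\ j < j',
  i' < i \/ i' = i :> nat /\ j' < j | i = i' /\ j = j'].
Proof.
case: (ltngtP i i') => [lt|lt|/val_inj->]; [by apply: Or31; left | by apply: Or32; left |].
by case: (ltngtP j j') => [lt|lt|/val_inj->];
  [apply: Or31; right | apply: Or32; right | apply: Or33].
Qed.

Lemma lex_trans : transitive lex.
Proof.
move=> g f h /lexP[i [j [fij gij eqfg]]] /lexP[i' [j' [gij' hij' eqgh]]]; apply/lexP.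
case: (ord_cmp i j i' j') => [lt|lt|[eqi eqj]].
- exists i, j; rewrite -eqgh //; split=> // k l ltk; rewrite eqfg // eqgh //.
  by move: lt ltk; lia.
- exists i', j'; rewrite eqfg //; split=> // k l ltk; rewrite eqfg ?eqgh //.
  by move: lt ltk; lia.
by move: gij'; rewrite -eqi -eqj gij.
Qed.

Lemma lex_total f g : ~~ lex f g -> ~~ lex g f -> f =2 g.
Proof.
move=> nfg ngf i j; apply/eqP/negPn/negP => neq.
pose m (u : 'I_n * 'I_n) := u.1 * n + u.2.
have [[{neq}i {}j] /= neq min_ij] := arg_minnP m (neq : [pred u | f u.1 u.2 != g u.1 u.2] (i, j)).
have eqfg (i' j' : 'I_n) : i' < i \/ i' = i :> nat /\ j' < j -> f i' j' = g i' j'.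
  move=> lt; apply/eqP; apply: contraTT isT => /(min_ij (i', j')); rewrite /m /=.
  have lt_j' := ltn_ord j'; case: lt => [lt|[-> lt]]; last by lia.
  have : i'.+1 * n <= i * n by rewrite leq_mul2r lt orbT.
  by rewrite mulSn; lia.
case fij: (f i j) neq => gij.
  by case/negP: ngf; apply/lexP; exists i, j; split=> // i' j' /eqfg->.
by case/negP: nfg; apply/lexP; exists i, j; rewrite fij; split=> //; case: (g i j) gij.
Qed.

(** Cotransitivity, which makes equality of copies the tie relation of a weak order. *)
Lemma lex_negtrans f g h : lex f g -> lex f h || lex h g.
Proof.
move=> fg; have [//|nfh] := boolP (lex f h).
have [hf|nhf] := boolP (lex h f); first by rewrite (lex_trans hf fg).
by rewrite -(@lex_eq f h g g) ?fg //; apply: lex_total.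
Qed.

End Lex.

Lemma card_ltn_ord n k : k <= n -> #|[set i : 'I_n | i < k]| = k.
Proof.
move=> le_kn; rewrite -sum1_card.
under eq_bigl do rewrite inE.
by rewrite -(big_ord_widen n (fun=> 1) le_kn) sum1_card card_ord.
Qed.

Section Copies.
Variables (V : finType) (e : rel V).
Local Notation num := 'I_(#|V|).+1.
Local Notation matrix := (num -> num -> bool).

(* The diagonal is included so that equal matrices have the same size. *)
Definition copy_of (B : {set V}) (M : matrix) (f : V -> num) :=
  [/\ {in B &, injective f}, forall u, u \in B -> f u < #|B|,
    {in B &, forall u v, M (f u) (f v) = (u == v) || e u v} &
    forall i j, M i j -> i < #|B| /\ j < #|B|].

Lemma copy_of_diag B M f i : copy_of B M f -> M i i = (i < #|B|).
Proof.
case=> f_inj f_lt fM M_lt; apply/idP/idP => [/M_lt[]//|lt_i].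
have sub : f @: B \subset [set j : num | j < #|B|].
  by apply/subsetP=> _ /imsetP[u uB ->]; rewrite inE f_lt.
have /eqP eq_im : f @: B == [set j : num | j < #|B|].
  rewrite eqEcard sub card_in_imset // card_ltn_ord ?leqnn //.
  exact: leq_trans (max_card _) (leqnSn _).
have : i \in f @: B by rewrite eq_im inE.
by case/imsetP=> u uB ->; rewrite fM // eqxx.
Qed.

Lemma copy_of_card B B' M M' f f' : copy_of B M f -> copy_of B' M' f' -> M =2 M' ->
  #|B| = #|B'|.
Proof.
move=> cB cB' eqM.
have iff i : i < #|V|.+1 -> (i < #|B|) = (i < #|B'|).
  by move=> lti; rewrite -(copy_of_diag (Ordinal lti) cB) -(copy_of_diag (Ordinal lti) cB') eqM.
have leB (C : {set V}) : #|C| < #|V|.+1 by rewrite ltnS max_card.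
by have := iff _ (leB B); have := iff _ (leB B'); rewrite !ltnn; lia.
Qed.

Variables (R Q : rel V).

(** Place [r] in the [q]-th of the parts tied with that of [u]: the summands count the vertices
    before the tied block, [q] whole parts, and the place. The first bound keeps [i] inside the
    block and so limits [q]. *)
Definition loc (W : rel V) u (i q r : num) :=
  [&& i < #|[set y | R u y && ~~ W u y]|, r < #|[set y | Q u y]| &
    i == #|[set y | R u y && W y u]| + q * #|[set y | Q u y]| + r :> nat].

Definition across a c := [exists u, exists v, [&& R a u, R a v, ~~ Q u v & e u v == c]].

(** The vertices [u] and [v] only stand for their tied blocks, while [q] and [q'] say which parts of
    the blocks are meant. Thus tied parts need no definable order. *)
Definition assemble (W : rel V) (can : V -> matrix) a : matrix := fun i j =>
  [exists u, exists v, exists q, exists r, exists q', exists r',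
    [&& R a u, R a v, loc W u i q r, loc W v j q' r' &
      if ~~ W u v && ~~ W v u then if q == q' then can u r r' else across a true
      else e u v]].

(** * Assembling the copies of the parts along a weak order [W] *)

Section Assembly.
Variables (W : rel V) (can : V -> matrix) (a : V).
Variable B : {set V}.
Hypothesis aB : a \in B.
Hypothesis R_in : forall x y, x \in B -> R x y = (y \in B).
Hypothesis Q_equiv : equivalence_rel Q.
Hypothesis Q_B : forall x y, x \in B -> Q x y -> y \in B.
Hypothesis W_irr : forall x, x \in B -> ~~ W x x.
Hypothesis W_trans : forall x y z, x \in B -> y \in B -> z \in B -> W x y -> W y z -> W x z.
Hypothesis W_neg : forall x y z, x \in B -> y \in B -> z \in B -> W x y -> W x z || W z y.
Let tie x y := ~~ W x y && ~~ W y x.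
Hypothesis Q_tie : forall x y, x \in B -> Q x y -> tie x y.
Hypothesis tie_can : forall x y, x \in B -> y \in B -> tie x y -> can x =2 can y.
Hypothesis can_copy : forall x, x \in B -> exists f, copy_of (class Q x) (can x) f.
Hypothesis e_tie : forall u v u' v', u \in B -> v \in B -> u' \in B -> v' \in B ->
  tie u u' -> tie v v' -> ~~ tie u v -> e u v = e u' v'.
Hypothesis e_across : forall u v, u \in B -> v \in B -> tie u v -> ~~ Q u v ->
  e u v = across a true.

Let off u := #|[set y | R u y && W y u]|.
Let lim u := #|[set y | R u y && ~~ W u y]|.
Let sz u := #|[set y | Q u y]|.

Lemma W_off x y : x \in B -> y \in B -> W x y = (off x < off y).
Proof.
move=> xB yB; apply/idP/idP => [xy|].
  apply: proper_card; apply/properP; split.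
    apply/subsetP=> z; rewrite !inE !R_in // => /andP[zB zx]; rewrite zB.
    exact: W_trans xy.
  by exists x; rewrite !inE R_in ?xB //= (negPf (W_irr xB)) ?andbF.
apply: contraTT => nxy; rewrite -leqNgt; apply: subset_leq_card.
apply/subsetP=> z; rewrite !inE !R_in // => /andP[zB zy]; rewrite zB.
by have := W_neg zB yB xB zy; rewrite (negPf nxy) orbF.
Qed.

Lemma tie_off x y : x \in B -> y \in B -> tie x y = (off x == off y).
Proof. by move=> xB yB; rewrite /tie !W_off //; lia. Qed.

Lemma Q_refl x : Q x x. Proof. by have [] := Q_equiv x x x. Qed.

Lemma Q_eq x y z : Q x y -> Q x z = Q y z.
Proof. by have [_] := Q_equiv x y z. Qed.

Let rep x := odflt x [pick y | Q x y].

Lemma Q_class_rep x : Q x (rep x).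
Proof. by rewrite /rep; case: pickP => //= _; apply: Q_refl. Qed.

Lemma class_rep_eq x y : (rep x == rep y) = Q x y.
Proof.
apply/eqP/idP => [eq_r|xy].
  by rewrite (Q_eq _ (Q_class_rep x)) eq_r -(Q_eq _ (Q_class_rep y)) Q_refl.
rewrite /rep (eq_pick (fun z => Q_eq z xy)); case: pickP => // /(_ y).
by rewrite Q_refl.
Qed.

(** An arbitrary tie-breaker between tied parts; it occurs in the proof only, not in the matrix. *)
Let rk x : nat := enum_rank (rep x).

Lemma rk_eq x y : (rk x == rk y) = Q x y.
Proof. by rewrite -class_rep_eq (inj_eq val_inj) (inj_eq enum_rank_inj). Qed.

Let before x y := (off x < off y) || (off x == off y) && (rk x < rk y).
Let pre u := #|[set y | R u y && before y u]|.

Lemma Q_off x y : x \in B -> Q x y -> off x = off y.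
Proof. by move=> xB xy; apply/eqP; rewrite -tie_off ?(Q_B xB xy) // Q_tie. Qed.

Lemma Q_sz x y : Q x y -> sz x = sz y.
Proof. by move=> xy; apply: eq_card => z; rewrite !inE (Q_eq _ xy). Qed.

Lemma before_cases x y : x \in B -> y \in B -> [|| Q x y, before x y | before y x].
Proof.
move=> xB yB; rewrite -rk_eq /before.
by move: (off x) (off y) (rk x) (rk y) => ox oy kx ky; lia.
Qed.

Lemma pre_sz x y : x \in B -> y \in B -> before x y -> pre x + sz x <= pre y.
Proof.
move=> xB yB xy; rewrite -cardsUI.
have -> : [set z | R x z && before z x] :&: [set z | Q x z] = set0.
  apply/setP=> z; rewrite !inE; apply/negP=> /andP[/andP[_ zx] xz].
  by move: zx; rewrite /before (Q_off xB xz) -[rk z](eqP (etrans (rk_eq _ _) xz)); lia.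
rewrite cards0 addn0; apply: subset_leq_card; apply/subsetP=> z; rewrite !inE R_in // [R y z]R_in //.
case/orP=> [/andP[-> zx]|xz]; first by move: zx xy; rewrite /before; lia.
rewrite (Q_B xB xz) /=; move: xy; rewrite /before (Q_off xB xz).
by rewrite [rk x](eqP (etrans (rk_eq _ _) xz)).
Qed.

Lemma pre_sz_lim x : x \in B -> pre x + sz x <= lim x.
Proof.
move=> xB; rewrite -cardsUI.
have -> : [set z | R x z && before z x] :&: [set z | Q x z] = set0.
  apply/setP=> z; rewrite !inE; apply/negP=> /andP[/andP[_ zx] xz].
  by move: zx; rewrite /before (Q_off xB xz) -[rk z](eqP (etrans (rk_eq _ _) xz)); lia.
rewrite cards0 addn0; apply: subset_leq_card; apply/subsetP=> z; rewrite !inE R_in //.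
case/orP=> [/andP[zB]|xz]; last first.
  by have := Q_tie xB xz; rewrite (Q_B xB xz) => /andP[->].
by rewrite zB W_off // /before; lia.
Qed.

Lemma lim_B x : x \in B -> lim x <= #|B|.
Proof.
by move=> xB; apply: subset_leq_card; apply/subsetP=> y; rewrite !inE R_in // => /andP[].
Qed.

Lemma lim_off x y : x \in B -> y \in B -> off x < off y -> lim x <= off y.
Proof.
move=> xB yB; rewrite -W_off // => xy; apply: subset_leq_card; apply/subsetP=> z.
rewrite !inE !R_in // => /andP[zB nxz]; rewrite zB.
by have := W_neg xB yB zB xy; rewrite (negPf nxz).
Qed.

Lemma tie_sz x y : x \in B -> y \in B -> off x = off y -> sz x = sz y.
Proof.
move=> xB yB /eqP; rewrite -tie_off // => xy.
have [f cf] := can_copy xB; have [g cg] := can_copy yB.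
exact: copy_of_card cf cg (tie_can xB yB xy).
Qed.

(** Between the start of the block and the part of [x] there are only whole parts tied with it, all
    of the same size since their copies are equal. *)
Lemma sz_dvd x : x \in B -> off x <= pre x /\ sz x %| pre x - off x.
Proof.
move=> xB; pose T := [set y in B | (off y == off x) && (rk y < rk x)].
have -> : pre x = off x + #|T|.
  rewrite -cardsUI.
  have -> : [set y | R x y && W y x] :&: T = set0.
    by apply/setP=> y; rewrite !inE !R_in //; case yB: (y \in B); rewrite // W_off //=; lia.
  rewrite cards0 addn0; apply: eq_card => y; rewrite !inE !R_in //.
  by case yB: (y \in B); rewrite // W_off.
split; first exact: leq_addr.
rewrite addKn.
have eqT : {in T & &, equivalence_rel Q} by move=> u v w _ _ _; apply: Q_equiv.
have partT := equivalence_partitionP eqT.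
rewrite (card_uniform_partition (n := sz x) _ partT) ?dvdn_mull //.
move=> _ /imsetP[y yT ->]; move: (yT); rewrite inE => /and3P[yB /eqP off_y rk_y].
rewrite -(tie_sz yB xB off_y); apply: eq_card => z; rewrite !inE; case yz: (Q y z); rewrite ?andbF //.
by rewrite (Q_B yB yz) -(Q_off yB yz) off_y eqxx -[rk z](eqP (etrans (rk_eq _ _) yz)) rk_y.
Qed.

(** A vertex goes to the number of vertices in earlier parts plus its place in the copy of its own
    part; it remains to see that witnesses in [assemble] can only recover these numbers. *)
Lemma assemble_copy : exists f, copy_of B (assemble W can a) f.
Proof.
have /fin_all_exists[G copyG] : forall x, exists g : V -> num, x \in B -> copy_of (class Q x) (can x) g.
  move=> x; have [xB|nxB] := boolP (x \in B); last by exists (fun=> ord0).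
  by have [g cg] := can_copy xB; exists g.
(* Passing through the representative makes all vertices of a part use the same copying map. *)
pose g u := G (rep u) u.
have repB u : u \in B -> rep u \in B by move=> uB; apply: Q_B uB (Q_class_rep u).
have lt_g u : u \in B -> g u < sz u.
  move=> uB; have [_ + _ _] := copyG _ (repB u uB); rewrite (Q_sz (Q_class_rep u)); apply.
  by rewrite inE -(Q_eq _ (Q_class_rep u)) Q_refl.
pose pos u : num := inord (pre u + g u).
have pos_lim u : u \in B -> pre u + g u < lim u.
  by move=> uB; have := pre_sz_lim uB; have := lt_g u uB; lia.
have posE u : u \in B -> pos u = pre u + g u :> nat.
  move=> uB; rewrite inordK //; apply: leq_trans (pos_lim u uB) _.
  exact: leq_trans (lim_B uB) (leq_trans (max_card _) (leqnSn _)).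
have pos_inj : {in B &, injective pos}.
  move=> u v uB vB /(congr1 val) /=; rewrite !posE // => eq_pos.
  case/or3P: (before_cases uB vB) => [uv|uv|vu].
  - have [g_inj _ _ _] := copyG _ (repB u uB).
    have eq_rep : rep u = rep v by apply/eqP; rewrite class_rep_eq.
    apply: g_inj; rewrite ?inE -?(Q_eq _ (Q_class_rep u)) ?Q_refl //.
    apply: val_inj; move: eq_pos; rewrite /g -eq_rep.
    suff -> : pre u = pre v by move/addnI.
    apply: eq_card => z; rewrite !inE !R_in // /before (Q_off uB uv).
    by rewrite [rk u](eqP (etrans (rk_eq _ _) uv)).
  - by have := pre_sz uB vB uv; have := lt_g u uB; lia.
  by have := pre_sz vB uB vu; have := lt_g v vB; lia.
pose q u : num := inord ((pre u - off u) %/ sz u).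
have qE u : u \in B -> pre u = off u + q u * sz u.
  move=> uB; have [le_off dvd] := sz_dvd uB.
  rewrite inordK; first by rewrite divnK // subnKC.
  rewrite ltnS (leq_trans (leq_div _ _)) // (leq_trans (leq_subr _ _)) //.
  apply: leq_trans (leq_trans (lim_B uB) (max_card _)).
  exact: ltnW (leq_ltn_trans (leq_addr _ _) (pos_lim u uB)).
have loc_pos u : u \in B -> loc W u (pos u) (q u) (g u).
  move=> uB; rewrite /loc posE // -/(lim u) -/(sz u) -/(off u) pos_lim // lt_g //=.
  by rewrite {1}(qE u uB).
(* The intervals of positions of distinct blocks are disjoint, so [x] is tied with [u]; inside a
   block, division by the common size determines [k] and [r]. *)
have loc_uniq x u k r : x \in B -> u \in B -> loc W x (pos u) k r ->
    [/\ off x = off u, k = q u & r = g u].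
  move=> xB uB /and3P[]; rewrite -/(lim x) -/(sz x) -/(off x) posE // => lt_lim lt_r /eqP eq_pos.
  have eq_off : off x = off u.
    have le_u := (sz_dvd uB).1; have lt_u := pos_lim u uB.
    case: (ltngtP (off x) (off u)) => // [/(lim_off xB uB)|/(lim_off uB xB)]; lia.
  move: eq_pos lt_r; rewrite (tie_sz xB uB eq_off) eq_off (qE u uB) -!addnA => /addnI eq_pos lt_r.
  have lt_gu := lt_g u uB; have sz_gt0 : 0 < sz u by apply: leq_ltn_trans lt_gu.
  have eq_k : k = q u :> nat.
    have := congr1 (fun m => m %/ sz u) eq_pos.
    by rewrite !divnMDl // !divn_small // !addn0.
  split=> //; first exact: val_inj.
  by apply: val_inj; move: eq_pos; rewrite eq_k => /addnI.
have q_eq u v : u \in B -> v \in B -> off u = off v -> (q u == q v) = Q u v.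
  move=> uB vB eq_off; have eq_sz := tie_sz uB vB eq_off.
  have sz_gt0 : 0 < sz v by apply: leq_ltn_trans (lt_g v vB).
  apply/eqP/idP => [eq_q|uv].
    case/or3P: (before_cases uB vB) => // [/(pre_sz uB vB)|/(pre_sz vB uB)];
      rewrite !qE // eq_q eq_sz eq_off; lia.
  rewrite /q eq_off eq_sz; congr (inord ((_ - _) %/ _)).
  apply: eq_card => z; rewrite !inE !R_in // /before eq_off.
  by rewrite [rk u](eqP (etrans (rk_eq _ _) uv)).
exists pos; split=> //.
- by move=> u uB; rewrite posE //; apply: leq_trans (pos_lim u uB) (lim_B uB).
- move=> u v uB vB.
  pose body u' v' (k r k' r' : num) :=
    if ~~ W u' v' && ~~ W v' u' then if k == k' then can u' r r' else across a true
    else e u' v'.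
  (* Witnesses are known only up to ties, so the entry is computed for any vertices tied with [u]
     and [v]. *)
  have bodyE u' v' : u' \in B -> v' \in B -> off u' = off u -> off v' = off v ->
      body u' v' (q u) (g u) (q v) (g v) = (u == v) || e u v.
    move=> u'B v'B eq_u eq_v; rewrite /body -/(tie u' v') tie_off // eq_u eq_v.
    case: eqP => [eq_off|neq_off].
      rewrite q_eq //; case uv: (Q u v).
        have eq_rep : rep u = rep v by apply/eqP; rewrite class_rep_eq.
        have [_ _ canE _] := copyG _ (repB u uB).
        have tie_u' : tie u' (rep u).
          by rewrite tie_off ?repB // eq_u (Q_off uB (Q_class_rep u)).
        rewrite (tie_can u'B (repB u uB) tie_u') /g -eq_rep canE ?inE //.
          by rewrite -(Q_eq _ (Q_class_rep u)) Q_refl.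
        by rewrite -(Q_eq _ (Q_class_rep u)).
      rewrite -(e_across uB vB) ?uv ?tie_off ?eq_off //.
      by case: eqP uv => // ->; rewrite Q_refl.
    rewrite -(e_tie uB vB u'B v'B) ?tie_off ?eq_u ?eq_v //; last exact/eqP.
    by case: eqP neq_off => // ->.
  apply/idP/idP => [|euv].
    case/existsP=> u' /existsP[v' /existsP[k /existsP[r /existsP[k' /existsP[r']]]]].
    rewrite !R_in // => /and5P[u'B v'B /(loc_uniq _ _ _ _ u'B uB)[eq_u -> ->]].
    case/(loc_uniq _ _ _ _ v'B vB)=> [eq_v -> ->].
    by rewrite -/(body u' v' (q u) (g u) (q v) (g v)) bodyE.
  apply/existsP; exists u; apply/existsP; exists v; apply/existsP; exists (q u).
  apply/existsP; exists (g u); apply/existsP; exists (q v); apply/existsP; exists (g v).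
  rewrite !R_in // uB vB !loc_pos //=.
  by rewrite -/(body u v (q u) (g u) (q v) (g v)) bodyE.
move=> i j /existsP[u /existsP[v /existsP[k /existsP[r /existsP[k' /existsP[r']]]]]].
rewrite !R_in // => /and5P[uB vB /and3P[lt_i _ _] /and3P[lt_j _ _] _].
by split; [apply: leq_trans lt_i (lim_B uB) | apply: leq_trans lt_j (lim_B vB)].
Qed.

End Assembly.
End Copies.

(** * The canonical copy *)

Section Recursion.
Variables (V : finType) (e : rel V).
Local Notation num := 'I_(#|V|).+1.
Local Notation matrix := (num -> num -> bool).

Section Definitions.
Variables (R Q : rel V) (can : V -> matrix).

Definition uniform a := ~~ (across e R Q a true && across e R Q a false).

Definition child_order a : rel V := fun u v =>
  if uniform a then lex (can u) (can v) else forced e (class R a) Q a u v.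

Definition candidate a : matrix := assemble e R Q (child_order a) can a.

Definition good a := uniform a || valid e (class R a) Q a.

(** Several [a] may be least, but then their candidates agree in every entry, so the existential
    quantifier does not mix different matrices. *)
Definition canon_step x : matrix := fun i j =>
  [exists a, [&& R x a, good a, candidate a i j &
    [forall b, (R x b && good b) ==> ~~ lex (candidate b) (candidate a)]]].

End Definitions.

(* Levels are counted from the bottom: level 0 consists of singletons and level
   [#|V|] of the single class [V]. *)
Definition part t := level e (#|V| - t).

(** The copy of a singleton has one true entry, as copies include the diagonal. *)
Fixpoint canon t : V -> matrix :=
  if t is t'.+1 then canon_step (part t) (part t') (canon t')
  else fun _ i j => (i == ord0) && (j == ord0).

Hypothesis e_sym : symmetric e.

Section Step.
Variables (d : nat) (can : V -> matrix).
Let R := level e d.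
Let Q := level e d.+1.
Hypothesis can_copy : forall x, exists f, copy_of e (class Q x) (can x) f.
Hypothesis can_eq : forall x y, Q x y -> can x =2 can y.

Lemma R_in a x y : x \in class R a -> R x y = (y \in class R a).
Proof. by rewrite /R !inE => ax; have [_ ->] := level_equiv e_sym d a x y. Qed.

Lemma Q_child a : {in class R a &, Q =2 child e (class R a)}.
Proof.
move=> x y xB yB; have ax : R a x by rewrite inE in xB.
by rewrite (level_class e_sym ax); apply: level_child; rewrite -/R (R_in _ xB).
Qed.

Lemma Q_in a x y : x \in class R a -> Q x y -> y \in class R a.
Proof. by move=> xB /andP[xy _]; rewrite -(R_in _ xB). Qed.

Lemma across_crossing a c : a \in class R a -> across e R Q a c = crossing e (class R a) c.
Proof.
move=> aB; apply: eq_existsb => u; apply: eq_existsb => v.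
rewrite !(R_in _ aB); case uB: (u \in _) => //=; case vB: (v \in _) => //=.
by rewrite (Q_child uB vB).
Qed.

Lemma class_refl a : a \in class R a.
Proof. by rewrite inE; apply: level_refl. Qed.

Lemma uniformE a : uniform R Q a = degenerate e (class R a).
Proof. by rewrite /uniform !across_crossing ?class_refl. Qed.

(** The assembly is used in two ways. If adjacency between parts is constant, ties mean equal
    copies; if the forced order is valid, they mean lying in the same part. *)
Lemma candidate_copy a : good R Q a -> exists f, copy_of e (class R a) (candidate R Q can a) f.
Proof.
move=> good_a; set B := class R a.
have sub u v : u \in B -> Q u v -> v \in B by apply: Q_in.
have QE : {in B &, Q =2 child e B} by apply: Q_child.
have Qxx u : Q u u by apply: level_refl.
rewrite /candidate; set W := child_order R Q can a.
have [deg|ndeg] := boolP (uniform R Q a).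
  have WE u v : W u v = lex (can u) (can v) by rewrite /W /child_order deg.
  have crossE u v : u \in B -> v \in B -> ~~ Q u v -> e u v = across e R Q a true.
    move=> uB vB nuv; rewrite across_crossing ?class_refl //.
    by apply: crossing_unique; rewrite -?uniformE -?QE.
  have Qtie u v : Q u v -> ~~ W u v && ~~ W v u.
    move=> uv; rewrite !WE (lex_eq (can_eq uv) (fun _ _ => erefl)) lex_irr.
    by rewrite (@lex_eq _ (can v) (can v) (can u) (can v)) ?lex_irr //; apply: can_eq.
  have tieE u v : ~~ W u v && ~~ W v u -> can u =2 can v.
    by rewrite !WE => /andP[]; apply: lex_total.
  apply: assemble_copy => //.
  - exact: class_refl.
  - exact: R_in.
  - exact: level_equiv.
  - by move=> x _; rewrite WE lex_irr.
  - by move=> x y z _ _ _; rewrite !WE; apply: lex_trans.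
  - by move=> x y z _ _ _; rewrite !WE; apply: lex_negtrans.
  - by move=> x y _; apply: Qtie.
  - by move=> x y _ _; apply: tieE.
  - move=> u v u' v' uB vB u'B v'B /tieE eq_u /tieE eq_v nuv.
    have nQ : ~~ Q u v by apply: contra nuv; apply: Qtie.
    have nQ' : ~~ Q u' v'.
      apply: contra nuv => /Qtie; rewrite !WE.
      by rewrite (lex_eq eq_u eq_v) (lex_eq eq_v eq_u).
    by rewrite !crossE.
  by move=> u v uB vB _; apply: crossE.
have WE u v : W u v = forced e B Q a u v by rewrite /W /child_order (negPf ndeg).
have valid_W u v : u \in B -> v \in B -> Q u v = ~~ W u v && ~~ W v u /\ ~~ (W u v && W v u).
  move=> uB vB; rewrite !WE; move: good_a; rewrite /good (negPf ndeg) /=.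
  move=> /forallP/(_ u)/forallP/(_ v)/implyP; rewrite uB vB.
  by case/(_ isT)/andP=> /eqP.
have Q_sym : {in B &, symmetric Q} by move=> u v uB vB; rewrite !QE // child_sym.
have Qtr u v w : Q u v -> Q v w -> Q u w by apply: level_trans.
have W_trans : transitive W by move=> v u w; rewrite !WE; apply: forced_trans.
apply: assemble_copy => //.
- exact: class_refl.
- exact: R_in.
- exact: level_equiv.
- by move=> x xB; have [_] := valid_W x x xB xB; rewrite andbb.
- by move=> x y z _ _ _; apply: W_trans.
(* Transitivity of [W] would exclude [W z x] and [W y z] as well, and then [Q] would join [x] to [z]
   and [z] to [y]. *)
- move=> x y z xB yB zB xy; apply/negPn/negP => /norP[nxz nzy].
  have [Qxz _] := valid_W x z xB zB; have [Qzy _] := valid_W z y zB yB.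
  have [Qxy _] := valid_W x y xB yB.
  move: Qxz Qzy; rewrite nxz nzy /=; case zx: (W z x) => /=.
    by rewrite (W_trans _ _ _ zx xy) in nzy.
  case yz: (W y z) => /=; first by rewrite (W_trans _ _ _ xy yz) in nxz.
  by move=> Qxz /(Qtr _ _ _ Qxz); rewrite Qxy xy.
- by move=> x y xB xy; have [<-] := valid_W x y xB (sub _ _ xB xy).
- by move=> x y xB yB tie_xy; apply: can_eq; have [->] := valid_W x y xB yB.
- move=> u v u' v' uB vB u'B v'B.
  have [<- _] := valid_W u u' uB u'B; have [<- _] := valid_W v v' vB v'B.
  have [<- _] := valid_W u v uB vB => uu' vv' nuv.
  have nu'v : ~~ Q u' v by apply: contra nuv; apply: Qtr.
  rewrite (@child_module V e e_sym B u u' v) -?QE // [LHS]e_sym [RHS]e_sym.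
  by apply: (@child_module V e e_sym B); rewrite -?QE // Q_sym.
move=> u v uB vB; have [<- _] := valid_W u v uB vB.
by move=> ->.
Qed.

Lemma canon_step_copy x : permutation_graph e ->
  exists f, copy_of e (class R x) (canon_step R Q can x) f.
Proof.
move=> perm_e.
have [a0 xa0 good_a0] : exists2 a, R x a & good R Q a.
  have [deg|ndeg] := boolP (uniform R Q x).
    by exists x; [apply: level_refl | rewrite /good deg].
  have ne : class R x != set0 by apply/set0Pn; exists x; apply: class_refl.
  rewrite uniformE in ndeg.
  have [a] := valid_exists e_sym (@Q_child x) (@Q_in x) perm_e ndeg ne.
  rewrite inE => xa valid_a; exists a => //.
  by rewrite /good -(level_class e_sym xa) valid_a orbT.
pose cand := candidate R Q can.
have [|||a /andP[xa good_a] min_a] :=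
  @exists_minimal V (fun a => R x a && good R Q a) (fun a b => lex (cand a) (cand b)) a0.
- by move=> a; apply: lex_irr.
- by move=> b a c; apply: lex_trans.
- by rewrite xa0.
have [f [f_inj f_lt fM M_lt]] := candidate_copy good_a.
have canE i j : canon_step R Q can x i j = cand a i j.
  apply/existsP/idP => [[b /and4P[xb good_b b_ij /forallP/(_ a)/implyP nab]]|a_ij].
    have lex_ba : ~~ lex (cand b) (cand a) by apply: min_a; rewrite xb good_b.
    have lex_ab : ~~ lex (cand a) (cand b) by apply: nab; rewrite xa good_a.
    by rewrite -(lex_total lex_ba lex_ab i j).
  exists a; rewrite -/cand xa good_a -/(cand a) a_ij; apply/forallP=> b.
  apply/implyP; exact: min_a.
rewrite (level_class e_sym xa); exists f; split=> //.
  by move=> u v uB vB; rewrite canE; apply: fM.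
by move=> i j; rewrite canE; apply: M_lt.
Qed.

Lemma canon_step_eq x y : R x y -> canon_step R Q can x =2 canon_step R Q can y.
Proof.
move=> xy i j; have RE z : R x z = R y z by rewrite /R; have [_ ->] := level_equiv e_sym d x y z.
apply: eq_existsb => a; rewrite RE; congr [&& _, _, _ & _].
by apply: eq_forallb => b; rewrite RE.
Qed.

End Step.

Lemma canonP t : permutation_graph e -> t <= #|V| ->
  (forall x, exists f, copy_of e (class (part t) x) (canon t x) f) /\
  (forall x y, part t x y -> canon t x =2 canon t y).
Proof.
move=> perm_e; elim: t => [_|t IHt lt_t]; split=> //=; last 2 first.
- have [copyt eqt] := IHt (ltnW lt_t); move: copyt eqt; rewrite /part.
  rewrite (_ : #|V| - t = (#|V| - t.+1).+1); last by lia.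
  by move=> copyt eqt x; apply: canon_step_copy.
- have [copyt eqt] := IHt (ltnW lt_t); move: copyt eqt; rewrite /part.
  rewrite (_ : #|V| - t = (#|V| - t.+1).+1); last by lia.
  by move=> copyt eqt x y; apply: canon_step_eq.
move=> x; have x_in : x \in class (part 0) x by rewrite inE; apply: level_refl.
have : #|class (part 0) x| <= 1.
  by apply: leq_trans (card_level_class e_sym _ x) _; rewrite subn0 subnn.
move=> le1.
have -> : class (part 0) x = [set x].
  by apply/esym/eqP; rewrite eqEcard sub1set x_in cards1.
exists (fun=> ord0); split.
- by move=> u v /set1P-> /set1P->.
- by move=> u _; rewrite cards1.
- by move=> u v /set1P-> /set1P->; rewrite !eqxx.
by move=> i j /andP[/eqP-> /eqP->]; rewrite cards1.
Qed.

End Recursion.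

(** * Formulas *)

(* Relation variables: 0 is the family of partitions of [fPart], 1 the family of
   ordered copies of [fCanon], 2 any other fixed point, 9 is reserved for calls.
   The variables 0, 1, .. of a formula [fX] are its arguments. *)
Definition fMem := FIfp 2 [:: (4, true)]
  (fOr (FEq 4 1) (fOr (FEq 4 2) (FAnd (FRel 0 [:: 0; 1; 4])
    (FExV 5 (FExV 6 (FAnd (FRel 2 [:: 5]) (FAnd (FRel 2 [:: 6])
      (FNot (fIff (FEdge 5 4) (FEdge 6 4)))))))))) [:: 3].
Definition cMem := fCall [:: false; true; true; true] fMem.

Definition fRefine := FAnd (FRel 0 [:: 0; 1; 2])
  (fOr (FEq 1 2) (FExV 3 (FAnd (FRel 0 [:: 0; 1; 3])
    (FAnd (FNot (cMem [:: 0; 1; 2; 3])) (cMem [:: 0; 1; 3; 2]))))).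
Definition cRefine := fCall [:: false; true; true] fRefine.

Definition fPart := FIfp 0 [:: (3, false); (4, true); (5, true)]
  (fOr (fMax 6 3) (FExN 7 (FAnd (fSucc 6 3 7)
    (FAnd (FExV 8 (FRel 0 [:: 7; 8; 8])) (cRefine [:: 7; 4; 5]))))) [:: 0; 1; 2].
Definition cPart := fCall [:: false; true; true] fPart.

Definition fAcross (c : bool) := FExV 3 (FExV 4 (FAnd (cPart [:: 0; 2; 3])
  (FAnd (cPart [:: 0; 2; 4]) (FAnd (FNot (cPart [:: 1; 3; 4]))
    (if c then FEdge 3 4 else FNot (FEdge 3 4)))))).
Definition cAcross c := fCall [:: false; false; true] (fAcross c).

Definition cUniform ts := FNot (FAnd (cAcross true ts) (cAcross false ts)).

Definition fFlip u v := fIte (FEdge u v) (FRel 2 [:: v; u]) (FRel 2 [:: u; v]).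
Definition fFlip2 u v := FExV 7 (FAnd (fFlip u 7) (fFlip 7 v)).
Definition fForced := FIfp 2 [:: (5, true); (6, true)]
  (fOr (FAnd (cPart [:: 0; 2; 5]) (FAnd (cPart [:: 0; 2; 6])
         (FAnd (cPart [:: 1; 2; 5]) (FNot (cPart [:: 1; 2; 6])))))
    (fOr (FExV 7 (FAnd (FRel 2 [:: 5; 7]) (FRel 2 [:: 7; 6])))
         (fIte (FEdge 5 6) (fFlip2 6 5) (fFlip2 5 6)))) [:: 3; 4].
Definition cForced := fCall [:: false; false; true; true; true] fForced.

Definition fValid := fAllV 3 (fAllV 4
  (fOr (FNot (FAnd (cPart [:: 0; 2; 3]) (cPart [:: 0; 2; 4])))
    (FAnd (fIff (cPart [:: 1; 3; 4])
             (FAnd (FNot (cForced [:: 0; 1; 2; 3; 4])) (FNot (cForced [:: 0; 1; 2; 4; 3]))))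
      (FNot (FAnd (cForced [:: 0; 1; 2; 3; 4]) (cForced [:: 0; 1; 2; 4; 3])))))).
Definition cValid := fCall [:: false; false; true] fValid.

Definition cGood ts := fOr (cUniform ts) (cValid ts).

(** Bound variables start at 10 so as not to capture the parameters of [f] and [g], which are below
    10. *)
Definition fLex (f g : nat -> nat -> fpc) :=
  FExN 10 (FExN 11 (FAnd (FNot (f 10 11)) (FAnd (g 10 11)
    (fAllN 12 (fAllN 13 (fOr
      (FNot (fOr (fLt 12 10) (FAnd (FEq 12 10) (fLt 13 11))))
      (fIff (f 12 13) (g 12 13)))))))).

Definition fLexCan := fLex (fun i j => FRel 1 [:: 0; 1; i; j]) (fun i j => FRel 1 [:: 0; 2; i; j]).
Definition cLexCan := fCall [:: false; true; true] fLexCan.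

Definition fOrder := fIte (cUniform [:: 0; 1; 2]) (cLexCan [:: 1; 3; 4])
  (cForced [:: 0; 1; 2; 3; 4]).
Definition cOrder := fCall [:: false; false; true; true; true] fOrder.

(** Multiplication is replaced by counting: from [(o, 0, 0)] the first component goes up by one
    while [(q, r)] runs like an odometer whose last digit has base [s]. *)
Definition fDiv := FIfp 2 [:: (5, false); (6, false); (7, false)]
  (fOr (FAnd (FEq 5 0) (FAnd (fZero 8 6) (fZero 8 7)))
    (FExN 8 (FExN 9 (FExN 10 (FAnd (FRel 2 [:: 8; 9; 10]) (FAnd (fSucc 11 8 5)
      (fIte (fSucc 11 10 1) (FAnd (fSucc 11 9 6) (fZero 11 7))
                            (FAnd (FEq 9 6) (fSucc 11 10 7)))))))))
  [:: 2; 3; 4].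
Definition cDiv := fCall [:: false; false; false; false; false] fDiv.

Definition fLoc := FExN 7 (FExN 8 (FExN 9
  (FAnd (FCnt 10 (FAnd (cPart [:: 0; 3; 10]) (cOrder [:: 0; 1; 2; 10; 3])) 7)
  (FAnd (FCnt 10 (cPart [:: 1; 3; 10]) 8)
  (FAnd (FCnt 10 (FAnd (cPart [:: 0; 3; 10]) (FNot (cOrder [:: 0; 1; 2; 3; 10]))) 9)
  (FAnd (fLt 4 9) (cDiv [:: 7; 8; 4; 5; 6]))))))).
Definition cLoc := fCall [:: false; false; true; true; false; false; false] fLoc.

Definition fCandidate := FExV 5 (FExV 6 (FExN 7 (FExN 8 (FExN 9 (FExN 10
  (FAnd (cPart [:: 0; 2; 5]) (FAnd (cPart [:: 0; 2; 6])
  (FAnd (cLoc [:: 0; 1; 2; 5; 3; 7; 8]) (FAnd (cLoc [:: 0; 1; 2; 6; 4; 9; 10])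
  (fIte (FAnd (FNot (cOrder [:: 0; 1; 2; 5; 6])) (FNot (cOrder [:: 0; 1; 2; 6; 5])))
     (fIte (FEq 7 9) (FRel 1 [:: 1; 5; 8; 10]) (cAcross true [:: 0; 1; 2]))
     (FEdge 5 6))))))))))).
Definition cCandidate := fCall [:: false; false; true; false; false] fCandidate.

Definition fLexCandidate :=
  fLex (fun i j => cCandidate [:: 0; 1; 2; i; j]) (fun i j => cCandidate [:: 0; 1; 3; i; j]).
Definition cLexCandidate := fCall [:: false; false; true; true] fLexCandidate.

Definition fStep := FExV 5 (FAnd (cPart [:: 0; 2; 5]) (FAnd (cGood [:: 0; 1; 5])
  (FAnd (cCandidate [:: 0; 1; 5; 3; 4])
    (fAllV 6 (fOr (FNot (FAnd (cPart [:: 0; 2; 6]) (cGood [:: 0; 1; 6])))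
      (FNot (cLexCandidate [:: 0; 1; 6; 5]))))))).
Definition cStep := fCall [:: false; false; true; false; false] fStep.

(** The guard asks for some diagonal entry at the level below, which every finished copy has. A step
    taken from copies still absent could add wrong tuples, and these would never be removed. *)
Definition fCanon := FIfp 1 [:: (4, false); (5, true); (6, false); (7, false)]
  (fOr (FAnd (fZero 8 4) (FAnd (fZero 8 6) (fZero 8 7)))
    (FExN 8 (FAnd (fSucc 9 8 4) (FAnd (FExV 9 (FExN 10 (FRel 1 [:: 8; 9; 10; 10])))
       (cStep [:: 4; 8; 5; 6; 7]))))) [:: 0; 1; 2; 3].
Definition cCanon := fCall [:: false; true; false; false] fCanon.

(* The universe consists of the numbers below [#|V|]; the sentence for the
   domain is valid, as 100 and 101 denote the number 0. *)
Definition canonization := Transduction [:: false]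
  (FLe 100 101) (FExN 1 (fLt 0 1)) (FEq 0 1)
  (FAnd (FNot (FEq 0 1)) (FExN 2 (FAnd (fMax 3 2) (FExV 4 (cCanon [:: 2; 4; 0; 1])))))
  (FLe 0 1).

Section Semantics.
Variables (V : finType) (e : rel V).
Local Notation num := 'I_(#|V|).+1.
Implicit Types (env : nat -> value V) (renv : nat -> seq (value V) -> bool).
Implicit Types (ts : seq nat) (t s i j q r : num) (x y z a u v : V).

Definition rel_of renv t : rel V := fun u v => renv 0 [:: inr t; inl u; inl v].
Definition can_of renv t u i j := renv 1 [:: inr t; inl u; inr i; inr j].

Lemma sem_cMem ts env renv t x y z :
    map env ts = [:: inr t; inl x; inl y; inl z] ->
  sem e (cMem ts) env renv = (z \in mclos e (class (rel_of renv t) x) x y).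
Proof.
move=> eq_ts; apply: sem_call; [by rewrite eq_ts | rewrite eq_ts => S].
apply: (sem_ifp (@encV_inj V)); [exact: encV_sorted | move=> X w | by []].
rewrite !semE [RHS]inE [_ \in class _ _]inE; congr [|| _, _ | _ && _].
apply: eq_existsb => p; rewrite semE; apply: eq_existsb => k.
by rewrite !semE -!(encSE (@encV_inj V)).
Qed.

Lemma sem_cRefine ts env renv t x y : map env ts = [:: inr t; inl x; inl y] ->
  sem e (cRefine ts) env renv = refine e (rel_of renv t) x y.
Proof.
move=> eq_ts; apply: sem_call; [by rewrite eq_ts | rewrite eq_ts => S].
rewrite !semE; congr (_ && (_ || _)).
apply: eq_existsb => z; rewrite !semE [z \in class _ _]inE.
by rewrite (sem_cMem _ (t := t) (x := x) (y := y) (z := z)) //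
  (sem_cMem _ (t := t) (x := x) (y := z) (z := y)).
Qed.

Definition part_step (X : {set num * V * V}) : {set num * V * V} :=
  [set w : num * V * V | (w.1.1 == #|V| :> nat) || [exists t : num, (t == w.1.1.+1 :> nat) &&
    ([exists u, (t, u, u) \in X] && refine e (fun u v => (t, u, v) \in X) w.1.2 w.2)]].

Definition canon_ifp_step (X : {set num * V * num * num}) : {set num * V * num * num} :=
  [set w : num * V * num * num | [&& w.1.1.1 == ord0, w.1.2 == ord0 & w.2 == ord0] ||
    [exists t : num, (w.1.1.1 == t.+1 :> nat) &&
      ([exists u, exists k, (t, u, k, k) \in X] &&
       canon_step e (part e w.1.1.1) (part e t) (fun u i j => (t, u, i, j) \in X)
         w.1.1.2 w.1.2 w.2)]].

Hypothesis e_sym : symmetric e.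

Lemma part_refl m x : part e m x x.
Proof. exact: level_refl. Qed.

Lemma part_top x y : part e #|V| x y.
Proof. by rewrite /part subnn. Qed.

Lemma part_refine m : m < #|V| -> part e m = refine e (part e m.+1).
Proof. by move=> lt_m; rewrite /part -[#|V| - m]prednK ?subn_gt0 // subnS. Qed.

Lemma part_ifp : ifp part_step = [set w : num * V * V | part e w.1.1 w.1.2 w.2].
Proof.
(* The top partition, numbered [#|V|], enters in the first round, so rounds run against the
   numbering. *)
apply: (ifp_staged (lvl := fun w : num * V * V => #|V| - w.1.1)) => [[[t x] y]|k X stageX [[t x] y]] /=.
  have V_gt0 : 0 < #|V| by rewrite (cardD1 x).
  rewrite !card_prod card_ord; apply: leq_ltn_trans (leq_subr _ _) _.
  by apply: leq_trans (leq_pmulr _ V_gt0); apply: leq_pmulr.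
have XE (t' : num) u v : ((t', u, v) \in X) = part e t' u v && (#|V| - t' < k).
  by rewrite stageX inE.
rewrite XE !inE /=; have [eq_t|neq_t] := eqVneq (t : nat) #|V|.
  by rewrite eq_t part_top subnn orbT.
have lt_t : t < #|V| by have := ltn_ord t; lia.
have lt_t1 : t.+1 < #|V|.+1 by [].
have lt_k : (#|V| - t < k.+1) = (#|V| - t.+1 < k) by lia.
have -> : [exists t' : num, (t' == t.+1 :> nat) &&
    ([exists u, (t', u, u) \in X] && refine e (fun u v => (t', u, v) \in X) x y)]
  = (#|V| - t.+1 < k) && part e t x y.
  have eqR (t' : num) : t' = t.+1 :> nat -> #|V| - t.+1 < k ->
      refine e (fun u v => (t', u, v) \in X) = part e t.
    move=> eq_t' lt_k'; rewrite part_refine //; congr (refine e _).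
    by do 2!apply: functional_extensionality => ?; rewrite XE eq_t' lt_k' andbT.
  apply/existsP/andP => [[t' /and3P[/eqP eq_t' /existsP[u]]]|[lt_k' xy]].
    by rewrite XE eq_t' => /andP[_ lt_k']; rewrite eqR.
  exists (Ordinal lt_t1); rewrite eqxx eqR // xy andbT.
  by apply/existsP; exists x; rewrite XE /= part_refl.
by rewrite lt_k; case: (part e t x y); rewrite ?andbF //= andbT; lia.
Qed.

Lemma sem_cPart ts env renv t x y : map env ts = [:: inr t; inl x; inl y] ->
  sem e (cPart ts) env renv = part e t x y.
Proof.
move=> eq_ts; apply: sem_call; [by rewrite eq_ts | rewrite eq_ts => S].
transitivity ((t, x, y) \in ifp part_step); last by rewrite part_ifp inE.
apply: (sem_ifp (@encNVV_inj V)); [exact: encNVV_sorted | move=> X w | by []].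
rewrite !semE [RHS]inE (sem_max _ (i := w.1.1)) //; congr (_ || _).
apply: eq_existsb => t'; rewrite !semE (sem_succ _ (i := w.1.1) (j := t')) //; congr (_ && (_ && _)).
  by apply: eq_existsb => u; rewrite -(encSE (@encNVV_inj V)).
rewrite (sem_cRefine _ (t := t') (x := w.1.2) (y := w.2)) //.
congr (refine e _ _ _); do 2!apply: functional_extensionality => ?.
by rewrite -(encSE (@encNVV_inj V)).
Qed.

Lemma sem_cAcross c ts env renv t t' a : map env ts = [:: inr t; inr t'; inl a] ->
  sem e (cAcross c ts) env renv = across e (part e t) (part e t') a c.
Proof.
move=> eq_ts; apply: sem_call; [by rewrite eq_ts | rewrite eq_ts => S].
rewrite semE; apply: eq_existsb => u; rewrite semE; apply: eq_existsb => v.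
rewrite !semE (sem_cPart _ (t := t) (x := a) (y := u)) //.
rewrite (sem_cPart _ (t := t) (x := a) (y := v)) // (sem_cPart _ (t := t') (x := u) (y := v)) //.
by case: c; rewrite ?semE (sem_edge _ (u := u) (v := v)) //; case: (e u v).
Qed.

Lemma sem_cUniform ts env renv t t' a : map env ts = [:: inr t; inr t'; inl a] ->
  sem e (cUniform ts) env renv = uniform e (part e t) (part e t') a.
Proof. by move=> eq_ts; rewrite !semE !(sem_cAcross _ _ eq_ts). Qed.

Lemma sem_fFlip2 k l env renv x y (X : {set V * V}) :
    env k = inl x -> env l = inl y -> k != 7 -> l != 7 -> renv 2 = encS (@encVV V) X ->
  sem e (fFlip2 k l) env renv = flip2 e X x y.
Proof.
move=> ek el /negPf k7 /negPf l7 eR; rewrite semE; apply: eq_existsb => z.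
have [ek' el'] : upd env 7 (inl z) k = inl x /\ upd env 7 (inl z) l = inl y.
  by rewrite /upd k7 l7.
have ez : upd env 7 (inl z) 7 = inl z by [].
rewrite !semE (sem_edge e _ ek' ez) (sem_edge e _ ez el').
rewrite /flip -!(encSE (@encVV_inj V)) -eR.
by rewrite /= ek' el'.
Qed.

Lemma sem_cForced ts env renv t t' a x y :
    map env ts = [:: inr t; inr t'; inl a; inl x; inl y] ->
  sem e (cForced ts) env renv = forced e (class (part e t) a) (part e t') a x y.
Proof.
move=> eq_ts; apply: sem_call; [by rewrite eq_ts | rewrite eq_ts => S].
apply: (sem_ifp (@encVV_inj V)); [exact: encVV_sorted | move=> X [u v] | by []].
rewrite 2!sem_or [RHS]inE; congr [|| _, _ | _].
- rewrite !semE (sem_cPart _ (t := t) (x := a) (y := u)) // (sem_cPart _ (t := t) (x := a) (y := v)) //.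
  rewrite (sem_cPart _ (t := t') (x := a) (y := u)) // (sem_cPart _ (t := t') (x := a) (y := v)) //.
  by rewrite !inE.
- by rewrite semE; apply: eq_existsb => z; rewrite -!(encSE (@encVV_inj V)).
rewrite sem_ite (sem_edge _ (u := u) (v := v)) //.
by rewrite (@sem_fFlip2 _ _ _ _ v u X) // (@sem_fFlip2 _ _ _ _ u v X).
Qed.

Lemma sem_cValid ts env renv t t' a : map env ts = [:: inr t; inr t'; inl a] ->
  sem e (cValid ts) env renv = valid e (class (part e t) a) (part e t') a.
Proof.
move=> eq_ts; apply: sem_call; [by rewrite eq_ts | rewrite eq_ts => S].
rewrite semE; apply: eq_forallb => x; rewrite semE; apply: eq_forallb => y.
rewrite !semE (sem_cPart _ (t := t) (x := a) (y := x)) // (sem_cPart _ (t := t) (x := a) (y := y)) //.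
rewrite (sem_cPart _ (t := t') (x := x) (y := y)) //.
rewrite (sem_cForced _ (t := t) (t' := t') (a := a) (x := x) (y := y)) //.
rewrite (sem_cForced _ (t := t) (t' := t') (a := a) (x := y) (y := x)) //.
by rewrite implybE !inE.
Qed.

Lemma sem_cGood ts env renv t t' a : map env ts = [:: inr t; inr t'; inl a] ->
  sem e (cGood ts) env renv = good e (part e t) (part e t') a.
Proof.
by move=> eq_ts; rewrite sem_or (sem_cUniform _ eq_ts) (sem_cValid _ eq_ts).
Qed.

Lemma sem_fLex f g (M M' : num -> num -> bool) env renv :
    (forall env' k l i j, (forall m, m < 10 -> env' m = env m) ->
       env' k = inr i -> env' l = inr j ->
       sem e (f k l) env' renv = M i j /\ sem e (g k l) env' renv = M' i j) ->
  sem e (fLex f g) env renv = lex M M'.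
Proof.
move=> semM; rewrite semE; apply: eq_existsb => i; rewrite semE; apply: eq_existsb => j.
have agree4 : forall h1 h2 h3 h4 m, m < 10 ->
    upd (upd (upd (upd env 10 h1) 11 h2) 12 h3) 13 h4 m = env m.
  by move=> h1 h2 h3 h4 m lt_m; rewrite /upd; do 4![case: eqP => [?|_]; first by exfalso; lia].
have agree2 : forall h1 h2 m, m < 10 -> upd (upd env 10 h1) 11 h2 m = env m.
  by move=> h1 h2 m lt_m; rewrite /upd; do 2![case: eqP => [?|_]; first by exfalso; lia].
have [eM eM'] := semM _ 10 11 i j (agree2 _ _) erefl erefl.
rewrite !semE eM eM'; congr [&& _, _ & _].
apply: eq_forallb => i'; rewrite semE; apply: eq_forallb => j'.
have [eN eN'] := semM _ 12 13 i' j' (agree4 (inr i) (inr j) _ _) erefl erefl.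
rewrite !semE eN eN' implybE (sem_lt _ (i := i') (j := i)) //.
by rewrite (sem_lt _ (i := j') (j := j)).
Qed.

Lemma sem_cLexCan ts env renv t x y : map env ts = [:: inr t; inl x; inl y] ->
  sem e (cLexCan ts) env renv = lex (can_of renv t x) (can_of renv t y).
Proof.
move=> eq_ts; apply: sem_call; [by rewrite eq_ts | rewrite eq_ts => S].
apply: sem_fLex => env' k l i j agree ek el.
by rewrite /= (agree 0) // (agree 1) // (agree 2) // ek el.
Qed.

Lemma sem_cOrder ts env renv t t' a u v :
    map env ts = [:: inr t; inr t'; inl a; inl u; inl v] ->
  sem e (cOrder ts) env renv
    = child_order e (part e t) (part e t') (can_of renv t') a u v.
Proof.
move=> eq_ts; apply: sem_call; [by rewrite eq_ts | rewrite eq_ts => S].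
rewrite sem_ite (sem_cUniform _ (t := t) (t' := t') (a := a)) //.
rewrite (sem_cLexCan _ (t := t') (x := u) (y := v)) //.
by rewrite (sem_cForced _ (t := t) (t' := t') (a := a) (x := u) (y := v)).
Qed.

Definition div_step (o s : num) (X : {set num * num * num}) : {set num * num * num} :=
  [set w : num * num * num | [&& w.1.1 == o, w.1.2 == ord0 & w.2 == ord0] ||
    [exists i : num, exists q : num, exists r : num,
      [&& (i, q, r) \in X, w.1.1 == i.+1 :> nat &
        if s == r.+1 :> nat then (w.1.2 == q.+1 :> nat) && (w.2 == ord0)
        else (q == w.1.2) && (w.2 == r.+1 :> nat)]]].

Lemma div_ifp (o s i q r : num) : 0 < s ->
  ((i, q, r) \in ifp (div_step o s)) = (i == o + q * s + r :> nat) && (r < s).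
Proof.
move=> s_gt0; apply/idP/andP => [|[/eqP eq_i lt_r]].
  pose S := [set w : num * num * num | (w.1.1 == o + w.1.2 * s + w.2 :> nat) && (w.2 < s)].
  suff sub : ifp (div_step o s) \subset S by move/(subsetP sub); rewrite inE => /andP.
  apply: ifp_min => X /subsetP sXS; apply/subsetP=> -[[i' q'] r']; rewrite !inE /=.
  case/orP=> [/and3P[/eqP-> /eqP-> /eqP->]|]; first by rewrite mul0n !addn0 eqxx.
  case/existsP=> i0 /existsP[q0 /existsP[r0 /and3P[/sXS]]]; rewrite inE /=.
  case/andP=> /eqP eq_i0 lt_r0 /eqP->; case: eqP => [eq_s|neq_s] /andP[/eqP eq1 /eqP eq2].
    by rewrite eq2 eq1 mulSn /=; lia.
  by rewrite -eq1 eq2; lia.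
have pred_num (k : num) : exists k' : num, k' = k.-1 :> nat.
  by exists (inord k.-1); rewrite inordK // (leq_ltn_trans (leq_pred _)).
have main m : forall i q r : num, m = q * s + r -> r < s -> i = o + m :> nat ->
    (i, q, r) \in ifp (div_step o s).
  elim: m => [|m IHm] {eq_i lt_r}i {}q {}r eq_m lt_r eq_i;
    apply: (subsetP (ifp_closed _)); rewrite inE /=; apply/orP; [left | right].
    rewrite -!val_eqE /= eq_i addn0 eqxx /=.
    by move/esym/eqP: eq_m; rewrite addn_eq0 muln_eq0 (gtn_eqF s_gt0) orbF.
  have [i' eq_i'] := pred_num i; apply/existsP; exists i'.
  (* The tuple counted just before has the pair [(q - 1, s - 1)] if [r] is 0, and [(q, r - 1)]
     otherwise. *)
  have [r0|r_gt0] := posnP r.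
    have q_gt0 : 0 < q by move: eq_m; rewrite r0; case: (q : nat).
    have [q' eq_q'] := pred_num q; apply/existsP; exists q'.
    have [r' eq_r'] := pred_num s; apply/existsP; exists r'.
    have lt_r' : r' < s by lia.
    have eq_m' : m = q' * s + r'.
      by move: eq_m; rewrite r0 -(prednK q_gt0) mulSn -eq_q'; lia.
    rewrite IHm //; last by lia.
    rewrite eq_i' eq_r' eq_q' -(val_eqE r) /= !prednK // ?eqxx ?r0 //.
    by rewrite eq_i; lia.
  apply/existsP; exists q; have [r' eq_r'] := pred_num r; apply/existsP; exists r'.
  rewrite IHm; [|lia..].
  rewrite eq_i' eq_r' !prednK // ?eqxx ?andbT //; last by rewrite eq_i; lia.
  by rewrite (gtn_eqF lt_r).
by apply: (main (q * s + r)) => //; rewrite addnA.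
Qed.

Lemma sem_cDiv ts env renv (o s i q r : num) : 0 < s ->
    map env ts = [:: inr o; inr s; inr i; inr q; inr r] ->
  sem e (cDiv ts) env renv = (i == o + q * s + r :> nat) && (r < s).
Proof.
move=> s_gt0 eq_ts; rewrite -div_ifp //; apply: sem_call; [by rewrite eq_ts | rewrite eq_ts => S].
apply: (sem_ifp (@encNNN_inj V)); [exact: encNNN_sorted | move=> X [[i' q'] r'] | by []].
rewrite !semE [RHS]inE (sem_zero _ (i := q')) // (sem_zero _ (i := r')) //; congr (_ || _).
apply: eq_existsb => i0; rewrite semE; apply: eq_existsb => q0; rewrite semE.
apply: eq_existsb => r0; rewrite !semE (sem_succ _ (i := i0) (j := i')) //.
rewrite (sem_succ _ (i := r0) (j := s)) // (sem_succ _ (i := q0) (j := q')) //.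
rewrite (sem_zero _ (i := r')) // (sem_succ _ (i := r0) (j := r')) //.
by rewrite -(encSE (@encNNN_inj V)).
Qed.

Lemma sem_cLoc ts env renv t t' a u i q r :
    map env ts = [:: inr t; inr t'; inl a; inl u; inr i; inr q; inr r] ->
  sem e (cLoc ts) env renv
    = loc (part e t) (part e t')
        (child_order e (part e t) (part e t') (can_of renv t') a) u i q r.
Proof.
move=> eq_ts; apply: sem_call; [by rewrite eq_ts | rewrite eq_ts => S].
set W := child_order _ _ _ _ _.
have card_num (A : {set V}) : #|A| < #|V|.+1 by rewrite ltnS max_card.
transitivity [exists o : num, exists s : num, exists b : num,
    [&& #|[set y | part e t u y && W y u]| == o, #|[set y | part e t' u y]| == s,
        #|[set y | part e t u y && ~~ W u y]| == b, i < b & (i == o + q * s + r :> nat) && (r < s)]].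
  rewrite semE; apply: eq_existsb => o; rewrite semE; apply: eq_existsb => s.
  rewrite semE; apply: eq_existsb => b; rewrite !sem_and.
  rewrite (sem_cnt (k := o) (P := fun y => part e t u y && W y u)) //; last first.
    move=> y; rewrite sem_and (sem_cPart _ (t := t) (x := u) (y := y)) //.
    by rewrite (sem_cOrder _ (t := t) (t' := t') (a := a) (u := y) (v := u)).
  rewrite (sem_cnt (k := s) (P := part e t' u)) //; last first.
    by move=> y; rewrite (sem_cPart _ (t := t') (x := u) (y := y)).
  rewrite (sem_cnt (k := b) (P := fun y => part e t u y && ~~ W u y)) //; last first.
    move=> y; rewrite sem_and (sem_cPart _ (t := t) (x := u) (y := y)) // sem_not.
    by rewrite (sem_cOrder _ (t := t) (t' := t') (a := a) (u := u) (v := y)).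
  congr (_ && _); case: eqP => [eq_s|//].
  have s_gt0 : 0 < s by rewrite -eq_s; apply/card_gt0P; exists u; rewrite inE part_refl.
  by rewrite (sem_lt _ (i := i) (j := b)) // (sem_cDiv _ (o := o) (i := i) (q := q) (r := r) s_gt0).
rewrite /loc; apply/existsP/and3P => [[o /existsP[s /existsP[b]]]|[lt_i lt_r eq_i]].
  by case/and5P=> /eqP-> /eqP-> /eqP-> -> /andP[-> ->].
exists (Ordinal (card_num [set y | part e t u y && W y u])); apply/existsP.
exists (Ordinal (card_num [set y | part e t' u y])); apply/existsP.
exists (Ordinal (card_num [set y | part e t u y && ~~ W u y])).
by rewrite /= !eqxx lt_i lt_r eq_i.
Qed.

Lemma sem_cCandidate ts env renv t t' a i j :
    map env ts = [:: inr t; inr t'; inl a; inr i; inr j] ->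
  sem e (cCandidate ts) env renv
    = candidate e (part e t) (part e t') (can_of renv t') a i j.
Proof.
move=> eq_ts; apply: sem_call; [by rewrite eq_ts | rewrite eq_ts => S]; rewrite /candidate.
set W := child_order _ _ _ _ _.
rewrite semE; apply: eq_existsb => u; rewrite semE; apply: eq_existsb => v.
rewrite semE; apply: eq_existsb => q; rewrite semE; apply: eq_existsb => r.
rewrite semE; apply: eq_existsb => q'; rewrite semE; apply: eq_existsb => r'.
rewrite 4!sem_and 2!sem_ite (sem_cPart _ (t := t) (x := a) (y := u)) //.
rewrite (sem_cPart _ (t := t) (x := a) (y := v)) //.
rewrite (sem_cLoc _ (t := t) (t' := t') (a := a) (u := u) (i := i) (q := q) (r := r)) //.
rewrite (sem_cLoc _ (t := t) (t' := t') (a := a) (u := v) (i := j) (q := q') (r := r')) //.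
rewrite sem_and !sem_not (sem_cOrder _ (t := t) (t' := t') (a := a) (u := u) (v := v)) //.
rewrite (sem_cOrder _ (t := t) (t' := t') (a := a) (u := v) (v := u)) //.
rewrite (sem_edge _ (u := u) (v := v)) // (sem_eqN _ (i := q) (j := q')) //.
by rewrite (sem_cAcross _ _ (t := t) (t' := t') (a := a)).
Qed.

Lemma sem_cLexCandidate ts env renv t t' a b :
    map env ts = [:: inr t; inr t'; inl a; inl b] ->
  sem e (cLexCandidate ts) env renv
    = lex (candidate e (part e t) (part e t') (can_of renv t') a)
          (candidate e (part e t) (part e t') (can_of renv t') b).
Proof.
move=> eq_ts; apply: sem_call; [by rewrite eq_ts | rewrite eq_ts => S].
apply: sem_fLex => env' k l i j agree ek el; split.
  rewrite (sem_cCandidate _ (t := t) (t' := t') (a := a) (i := i) (j := j)) //.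
  by rewrite /= (agree 0) // (agree 1) // (agree 2) // ek el.
rewrite (sem_cCandidate _ (t := t) (t' := t') (a := b) (i := i) (j := j)) //.
by rewrite /= (agree 0) // (agree 1) // (agree 3) // ek el.
Qed.

Lemma sem_cStep ts env renv t t' x i j :
    map env ts = [:: inr t; inr t'; inl x; inr i; inr j] ->
  sem e (cStep ts) env renv
    = canon_step e (part e t) (part e t') (can_of renv t') x i j.
Proof.
move=> eq_ts; apply: sem_call; [by rewrite eq_ts | rewrite eq_ts => S].
rewrite semE; apply: eq_existsb => a; rewrite 3!sem_and.
rewrite (sem_cPart _ (t := t) (x := x) (y := a)) // (sem_cGood _ (t := t) (t' := t') (a := a)) //.
rewrite (sem_cCandidate _ (t := t) (t' := t') (a := a) (i := i) (j := j)) //.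
rewrite sem_allV; congr [&& _, _, _ & _]; apply: eq_forallb => b.
rewrite sem_or !sem_not sem_and implybE (sem_cPart _ (t := t) (x := x) (y := b)) //.
rewrite (sem_cGood _ (t := t) (t' := t') (a := b)) //.
by rewrite (sem_cLexCandidate _ (t := t) (t' := t') (a := b) (b := a)).
Qed.

Lemma canon_ifp : permutation_graph e ->
  ifp canon_ifp_step = [set w : num * V * num * num | canon e w.1.1.1 w.1.1.2 w.1.2 w.2].
Proof.
move=> perm_e.
apply: (ifp_staged (lvl := fun w : num * V * num * num => w.1.1.1)) => [[[[t x] i] j]|k X stageX [[[t x] i] j]] /=.
  have V_gt0 : 0 < #|V| by rewrite (cardD1 x).
  rewrite !card_prod card_ord; apply: leq_trans (ltn_ord t) _.
  by rewrite -!mulnA leq_pmulr // !muln_gt0 V_gt0.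
have XE (t' : num) u i' j' : ((t', u, i', j') \in X) = canon e t' u i' j' && (t' < k).
  by rewrite stageX inE.
rewrite XE !inE /=; have [eq_t|t_gt0] := posnP t.
  rewrite eq_t /= -(val_eqE t) /= eq_t eqxx /=.
  by case: existsP => [[t'] //|_]; case: (i == ord0); case: (j == ord0); case: (0 < k).
have -> : (t == ord0) = false by rewrite -val_eqE /= gtn_eqF.
have lt_p : t.-1 < #|V|.+1 by apply: leq_ltn_trans (leq_pred _) (ltn_ord t).
have eqR (t' : num) : t = t'.+1 :> nat -> t' < k ->
    canon_step e (part e t) (part e t') (fun u i j => (t', u, i, j) \in X) x i j = canon e t x i j.
  move=> -> lt_k; rewrite /=; congr (canon_step e _ _ _ x i j).
  by do 3!apply: functional_extensionality => ?; rewrite XE lt_k andbT.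
have -> : [exists t' : num, (t == t'.+1 :> nat) && ([exists u, exists m, (t', u, m, m) \in X] &&
     canon_step e (part e t) (part e t') (fun u i j => (t', u, i, j) \in X) x i j)]
  = (t.-1 < k) && canon e t x i j.
  apply/existsP/andP => [[t' /and3P[/eqP eq_t /existsP[u /existsP[m]]]]|[lt_k xij]].
    by rewrite XE => /andP[_ lt_k]; rewrite eqR // {2}eq_t.
  have eq_t : t = (Ordinal lt_p).+1 :> nat by rewrite /= prednK.
  exists (Ordinal lt_p); rewrite {1}eq_t eqxx (eqR _ eq_t lt_k) xij andbT.
  (* The guard is passed by the diagonal entry of [x] in its copy one level below. *)
  have [/(_ x)[f [_ _ fM _]] _] := canonP e_sym perm_e lt_p.
  apply/existsP; exists x; apply/existsP; exists (f x); rewrite XE /= lt_k andbT.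
  by rewrite fM ?eqxx // inE part_refl.
rewrite /= (_ : (t < k.+1) = (t.-1 < k)); last by lia.
by case: (canon e t x i j); rewrite ?andbF //= andbT; lia.
Qed.

Lemma sem_cCanon ts env renv t x i j : permutation_graph e ->
    map env ts = [:: inr t; inl x; inr i; inr j] ->
  sem e (cCanon ts) env renv = canon e t x i j.
Proof.
move=> perm_e eq_ts; apply: sem_call; [by rewrite eq_ts | rewrite eq_ts => S].
transitivity ((t, x, i, j) \in ifp canon_ifp_step); last by rewrite canon_ifp // inE.
apply: (sem_ifp (@encNVNN_inj V)); [exact: encNVNN_sorted | move=> X w | by []].
rewrite sem_or !sem_and [RHS]inE (sem_zero _ (i := w.1.1.1)) // (sem_zero _ (i := w.1.2)) //.
rewrite (sem_zero _ (i := w.2)) //; congr (_ || _).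
rewrite semE; apply: eq_existsb => t'; rewrite 2!sem_and (sem_succ _ (i := t') (j := w.1.1.1)) //.
congr (_ && (_ && _)).
  rewrite semE; apply: eq_existsb => u; rewrite semE; apply: eq_existsb => k.
  by rewrite -(encSE (@encNVNN_inj V)).
rewrite (sem_cStep _ (t := w.1.1.1) (t' := t') (x := w.1.1.2) (i := w.1.2) (j := w.2)); last by [].
have -> : can_of (updR (updR renv 9 S) 1 (encS (@encNVNN V) X)) t'
    = fun u i j => (t', u, i, j) \in X.
  do 3!apply: functional_extensionality => ?.
  by rewrite -(encSE (@encNVNN_inj V)).
reflexivity.
Qed.

End Semantics.

(** * The transduction *)

Section Canonization.
Variables (V : finType) (e : rel V).
Local Notation num := 'I_(#|V|).+1.
Hypotheses (e_sym : symmetric e) (e_irr : irreflexive e) (perm_e : permutation_graph e).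
Hypothesis V_gt0 : 0 < #|V|.

Definition elt (i : num) : ttuple canonization V := [tuple inr i].

Lemma elt_inj : injective elt.
Proof. by move=> i j /(congr1 val) []. Qed.

Lemma eltP (a : ttuple canonization V) : a \in t_universe canonization e ->
  exists2 i : num, a = elt i & i < #|V|.
Proof.
rewrite inE => /andP[]; case/tupleP: a => v a; rewrite (tuple0 a); case: v => [//|i _] /=.
case/existsP=> j; rewrite (sem_lt _ (i := i) (j := j)) // => lt_ij.
by exists i; [apply: val_inj | apply: leq_trans lt_ij _; rewrite -ltnS ltn_ord].
Qed.

Lemma elt_universe (i : num) : (elt i \in t_universe canonization e) = (i < #|V|).
Proof.
apply/idP/idP => [/eltP[j /elt_inj->]//|lt_i].
rewrite inE /=; apply/existsP; exists ord_max.
by rewrite (sem_lt _ (i := i) (j := ord_max)).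
Qed.

Lemma elt_eq i j : t_eq e (elt i) (elt j) = (i == j).
Proof. by []. Qed.

Lemma elt_le C D i j : C = [set elt i] -> D = [set elt j] -> out_le e C D = (i <= j).
Proof.
move=> -> ->; apply/existsP/idP => [[a /andP[/set1P->]]|le_ij].
  by case/existsP=> b /andP[/set1P->].
exists (elt i); rewrite set11; apply/existsP; exists (elt j); rewrite set11.
exact: le_ij.
Qed.

(** Any [x] will do, as level [#|V|] has a single class and so a single copy. Its diagonal, which is
    true, is cut out by [i != j]. *)
Lemma elt_edge i j x : out_edge e [set elt i] [set elt j] = (i != j) && canon e #|V| x i j.
Proof.
have semE a b : a = elt i -> b = elt j ->
    sem e (t_edge canonization) (tenv (tval a ++ tval b)) (@renv0 V)
      = (i != j) && canon e #|V| x i j.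
  move=> -> ->; rewrite /t_edge /canonization sem_and sem_not (sem_eqN _ (i := i) (j := j)) //.
  congr (_ && _); rewrite sem_exN; have [_ eq_can] := canonP e_sym perm_e (leqnn #|V|).
  have canE y : canon e #|V| y i j = canon e #|V| x i j.
    by apply: eq_can; apply: part_top.
  apply/existsP/idP => [[t]|can_ij].
    rewrite sem_and (sem_max _ (i := t)) // => /andP[/eqP eq_t]; rewrite sem_exV => /existsP[y].
    by rewrite (sem_cCanon e_sym _ (t := t) (x := y) (i := i) (j := j)) // eq_t canE.
  exists ord_max; rewrite sem_and (sem_max _ (i := ord_max)) // eqxx sem_exV; apply/existsP.
  exists x; by rewrite (sem_cCanon e_sym _ (t := ord_max) (x := x) (i := i) (j := j)).
apply/existsP/idP => [[a /andP[/set1P eq_a /existsP[b /andP[/set1P eq_b]]]]|edge_ij].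
  by rewrite semE.
exists (elt i); rewrite set11; apply/existsP; exists (elt j); rewrite set11.
by rewrite semE.
Qed.

Lemma classP C : C \in t_classes canonization e <-> exists2 i : num, C = [set elt i] & i < #|V|.
Proof.
have classE (i : num) : i < #|V| ->
    [set b in t_universe canonization e | t_eq e (elt i) b] = [set elt i].
  move=> lt_i; apply/setP=> b; rewrite 2!inE; apply/andP/eqP => [[/eltP[j -> _]]|->].
    by rewrite elt_eq => /eqP->.
  by rewrite elt_universe elt_eq eqxx lt_i.
split=> [/imsetP[a /eltP[i -> lt_i] ->]|[i -> lt_i]].
  by exists i; rewrite ?classE.
by apply/imsetP; exists (elt i); rewrite ?elt_universe ?classE.
Qed.

Lemma canonization_canonizes : canonizes canonization e.
Proof.
split.
- by [].
- split.
  + by move=> a /eltP[i -> _]; rewrite elt_eq.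
  + by move=> a b /eltP[i -> _] /eltP[j -> _]; rewrite !elt_eq eq_sym.
  by move=> a b c /eltP[i -> _] /eltP[j -> _] /eltP[k -> _]; rewrite !elt_eq => /eqP->.
- split.
  + move=> C D /classP[i eC _] /classP[j eD _].
    rewrite (elt_le eC eD) (elt_le eD eC) => le_ij le_ji; rewrite eC eD.
    by congr [set elt _]; apply/val_inj/eqP; rewrite eqn_leq le_ij.
  + move=> C D F /classP[i eC _] /classP[j eD _] /classP[k eF _].
    by rewrite (elt_le eC eD) (elt_le eD eF) (elt_le eC eF); apply: leq_trans.
  by move=> C D /classP[i eC _] /classP[j eD _]; rewrite (elt_le eC eD) (elt_le eD eC) leq_total.
have /card_gt0P[x _] := V_gt0.
have [/(_ x)[f [f_inj f_lt fM _]] _] := canonP e_sym perm_e (leqnn #|V|).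
have eqB : class (part e #|V|) x = setT by apply/setP=> y; rewrite !inE part_top.
have {}f_inj : injective f by move=> u v; apply: f_inj; rewrite eqB inE.
have {}f_lt u : f u < #|V| by have := f_lt u; rewrite eqB cardsT inE; apply.
exists (fun u => [set elt (f u)]); split.
- by move=> u v /set1_inj/elt_inj/f_inj.
- apply/setP=> C; apply/imsetP/idP => [[u _ ->]|/classP[i -> lt_i]].
    by apply/classP; exists (f u).
  have /eqP eq_im : f @: setT == [set j : num | j < #|V|].
    rewrite eqEcard card_imset // cardsT card_ltn_ord // leqnn andbT.
    by apply/subsetP=> _ /imsetP[u _ ->]; rewrite inE.
  have : i \in f @: setT by rewrite eq_im inE.
  by case/imsetP=> u uT ->; exists u.
move=> u v; rewrite (elt_edge _ _ x) fM ?eqB ?inE //.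
by rewrite (inj_eq f_inj); case: eqP => [->|] //; rewrite e_irr.
Qed.

End Canonization.

Theorem theorem5p9 : admits_FPC_canonization permutation_graph.
Proof.
exists canonization => V e [V_gt0 [e_sym e_irr]] perm_e.
exact: canonization_canonizes.
Qed.
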